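(* Let $(X_1\mid Y_1)$ be a finite subpresentation of a contractible presentation $(X\mid Y)$, let $Z$ be a set of cardinality $|X_1|-|Y_1|$, let $P_\bullet$ be the free simplicial group of the presentation $(X_1\mid Y_1)$, and let $\widehat P_\bullet$ be its degreewise rational prounipotent completion. Then there is a simplicial homotopy equivalence \[ \widehat P_\bullet\ \simeq\ \operatorname{Const}(F_{\mathbb Q}(Z)) \] realized in the category of simplicial prounipotent groups over $\mathbb Q$: there are morphisms of simplicial prounipotent groups $f:\widehat P_\bullet\to\operatorname{Const}(F_{\mathbb Q}(Z))$ and $g:\operatorname{Const}(F_{\mathbb Q}(Z))\to\widehat P_\bullet$, together with simplicial homotopies between $gf$ and the identity and between $fg$ and the identity, such that all components of these simplicial homotopies are morphisms of prounipotent groups.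
   Context: A presentation $(X\mid Y)$ consists of a set $X$ of generators and a set $Y$ of relators; the relator indexed by $y\in Y$ is a word $r_y\in\Phi(X)$, where $\Phi(X)$ is the free discrete group on $X$. Its standard presentation complex $K(X\mid Y)$ is the 2-dimensional CW-complex with one $0$-cell, one $1$-cell for each $x\in X$, and one $2$-cell for each $y\in Y$ attached along a loop representing $r_y$. The presentation is contractible if $K(X\mid Y)$ is contractible. A subpresentation $(X_1\mid Y_1)$ is a choice of subsets $X_1\subseteq X$, $Y_1\subseteq Y$ such that $r_y\in\Phi(X_1)$ for all $y\in Y_1$; it is finite if $X_1$ and $Y_1$ are finite. The free simplicial group $P_\bullet$ of $(X_1\mid Y_1)$ has free bases closed under degeneracies, with nondegenerate free generators $X_1$ in degree $0$, $Y_1$ in degree $1$, and none in degrees $\ge2$; in degree one $d_0(y)=1$ and $d_1(y)=r_y$. A prounipotent group over $\mathbb Q$ is an inverse limit of unipotent algebraic groups over $\mathbb Q$ (as an affine group scheme); morphisms are group-scheme morphisms. The prounipotent completion of a discrete group $G$ is the universal prounipotent group $G^\wedge_{\mathbb Q}$ over $\mathbb Q$ with a Zariski dense homomorphism $G\to G^\wedge_{\mathbb Q}(\mathbb Q)$. $F_{\mathbb Q}(Z)$ is the free prounipotent group on the finite set $Z$: the prounipotent completion of $\Phi(Z)$, equivalently the exponential of the degree-completed free Lie algebra over $\mathbb Q$ on $Z$. $\operatorname{Const}(G)$ is the constant simplicial group on $G$. The components of a simplicial homotopy between simplicial maps $A_\bullet\to B_\bullet$ are the maps $h_i:A_n\to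 B_{n+1}$, $0\le i\le n$, satisfying the usual identities. *)

(* Defs.v *)
From HB Require Import structures.
From mathcomp Require Import all_boot all_order all_algebra finmap.
From mathcomp Require Import all_classical all_reals.
From mathcomp Require Import topology normedtype zify.

Set Implicit Arguments.
Unset Strict Implicit.
Unset Printing Implicit Defensive.

Import Order.TTheory GRing.Theory Num.Theory.
Import numFieldNormedType.Exports.

Local Open Scope classical_set_scope.
Local Open Scope ring_scope.

Lemma multiplicative1 (G H : groupType) (h : {multiplicative G -> H}) :
  h 1%g = 1%g.
Proof. by apply: (mulgI (h 1%g)); rewrite -gmulfM !mulg1. Qed.

Section FreeGroup.
Variable X : choiceType.

(* (x, true) stands for x and (x, false) for x^-1. *)
Definition letter : Type := X * bool.
HB.instance Definition _ := Choice.on letter.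

Definition inv_letter (a : letter) : letter := (a.1, ~~ a.2).

Definition reduced (w : seq letter) : bool :=
  sorted (fun a b => b != inv_letter a) w.

Definition push (a : letter) (w : seq letter) : seq letter :=
  if w is b :: w' then if b == inv_letter a then w' else a :: w else [:: a].

Record free_group : Type :=
  FreeGroup { word :> seq letter; word_reduced : reduced word }.

HB.instance Definition _ := [isSub for word].
HB.instance Definition _ := [Choice of free_group by <:].

Lemma inv_letterK : involutive inv_letter.
Proof. by case=> x b; rewrite /inv_letter /= negbK. Qed.

Lemma push_reduced a w : reduced w -> reduced (push a w).
Proof.
case: w => [//|b w] /= rw; case: ifP => [_|/negbT ne]; first exact: path_sorted rw.
by rewrite /= ne.
Qed.

Lemma pushK a w : reduced w -> push (inv_letter a) (push a w) = w.
Proof.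
case: w => [|b w] /= rw; first by rewrite inv_letterK eqxx.
case: ifP => [/eqP eb|_]; last by rewrite /= inv_letterK eqxx.
subst b; case: w rw => [//|c w] /= /andP[+ _].
by rewrite inv_letterK => /negbTE ->.
Qed.

Lemma pushVK a w : reduced w -> push a (push (inv_letter a) w) = w.
Proof. by move=> rw; rewrite -{1}(inv_letterK a) pushK. Qed.

Lemma pushes_reduced u v : reduced v -> reduced (foldr push v u).
Proof. by move=> rv; elim: u => //= a u; apply: push_reduced. Qed.

Lemma pushes_push a u w : reduced w ->
  foldr push w (push a u) = push a (foldr push w u).
Proof.
move=> rw; case: u => [//|b u] /=; case: ifP => [/eqP->|//].
by rewrite pushVK // pushes_reduced.
Qed.

Lemma pushes_nil u : reduced u -> foldr push [::] u = u.
Proof.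
elim: u => //= a u IH ru; rewrite IH; last exact: path_sorted ru.
by case: u ru {IH} => //= b u /andP[/negbTE -> _].
Qed.

Definition fg_one : free_group := @FreeGroup [::] isT.
Definition fg_mul (u v : free_group) : free_group :=
  FreeGroup (pushes_reduced u (word_reduced v)).
Definition inv_word (w : seq letter) : seq letter := rev (map inv_letter w).

Lemma inv_word_reduced w : reduced w -> reduced (inv_word w).
Proof.
rewrite /reduced /inv_word rev_sorted sorted_map; apply: sub_sorted => a b /=.
by apply: contraNN => /eqP ->; rewrite !inv_letterK.
Qed.

Definition fg_inv (u : free_group) : free_group :=
  FreeGroup (inv_word_reduced (word_reduced u)).

Lemma fg_mulA : associative fg_mul.
Proof.
move=> u v w; apply: val_inj => /=; elim: (word u) => //= a s IH.
by rewrite pushes_push ?IH // word_reduced.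
Qed.

Lemma fg_mul1 : left_id fg_one fg_mul.
Proof. by move=> u; apply: val_inj. Qed.

Lemma fg_mulr1 : right_id fg_one fg_mul.
Proof. by move=> u; apply: val_inj; rewrite /= pushes_nil ?word_reduced. Qed.

Lemma fg_mulV : left_inverse fg_one fg_inv fg_mul.
Proof.
move=> u; apply: val_inj => /=; have := word_reduced u.
elim: (word u) => [//|a s IH] ru; have rs := path_sorted ru.
rewrite /inv_word /= rev_cons -cats1 foldr_cat /=.
by rewrite inv_letterK eqxx; exact: IH.
Qed.

Lemma fg_invK : involutive fg_inv.
Proof.
move=> u; apply: val_inj; rewrite /= /inv_word map_rev revK -map_comp.
by rewrite (eq_map inv_letterK) map_id.
Qed.

Lemma fg_mulrV : right_inverse fg_one fg_inv fg_mul.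
Proof. by move=> u; rewrite -{1}(fg_invK u) fg_mulV. Qed.

HB.instance Definition _ := isGroup.Build free_group
  fg_mulA fg_mul1 fg_mulr1 fg_mulV fg_mulrV.

Definition fg_gen (x : X) : free_group := @FreeGroup [:: (x, true)] isT.

Section Lift.
Variables (G : groupType) (f : X -> G).

Definition letter_val (a : letter) : G := if a.2 then f a.1 else (f a.1)^-1%g.

Definition fg_lift (u : free_group) : G :=
  foldr (fun a g => letter_val a * g)%g 1%g (word u).

Lemma fg_lift_is_multiplicative : {morph fg_lift : u v / (u * v)%g}.
Proof.
move=> u v; rewrite /fg_lift /=.
have evP a w : foldr (fun a g => letter_val a * g)%g 1%g (push a w)
    = (letter_val a * foldr (fun a g => letter_val a * g) 1 w)%g.
  case: w => [//|b w] /=; case: ifP => [/eqP ->|//].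
  by rewrite mulgA; case: a => x [] /=;
     rewrite /letter_val /= ?mulgV ?mulVg mul1g.
elim: (word u) => [|a s IH] /=; first by rewrite mul1g.
by rewrite evP IH mulgA.
Qed.

HB.instance Definition _ :=
  isMultiplicative.Build free_group G fg_lift fg_lift_is_multiplicative.

Lemma fg_lift_gen x : fg_lift (fg_gen x) = f x.
Proof. by rewrite /fg_lift /= mulg1. Qed.

End Lift.

Lemma fg_lift_unique (G : groupType) (h : {multiplicative free_group -> G}) :
  h =1 fg_lift (h \o fg_gen).
Proof.
case=> w; elim: w => [|[x b] w IH] rw.
  by rewrite -[RHS]/(1%g : G) -(multiplicative1 h); congr (h _); apply: val_inj.
have rw' : reduced w by exact: path_sorted rw.
pose l : free_group := @FreeGroup [:: (x, b)] isT.
have -> : FreeGroup rw = (l * FreeGroup rw')%g.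
  apply: val_inj => /=.
  by case: w rw {IH rw'} => [//|c w] /= /andP[/negbTE -> _].
rewrite gmulfM IH [RHS]fg_lift_is_multiplicative; congr (_ * _)%g.
rewrite /fg_lift /= mulg1 /letter_val /= /l; case: b {rw l} => //.
have -> : @FreeGroup [:: (x, false)] isT = (fg_gen x)^-1%g by apply: val_inj.
by apply: (mulgI (h (fg_gen x))); rewrite -gmulfM !mulgV multiplicative1.
Qed.

End FreeGroup.

Lemma fg_hom_ext (X : choiceType) (G : groupType)
    (h k : {multiplicative free_group X -> G}) :
  (forall x, h (fg_gen x) = k (fg_gen x)) -> h =1 k.
Proof.
move=> e u; rewrite (fg_lift_unique h) (fg_lift_unique k).
by congr (fg_lift _ u); apply/funext => x /=.
Qed.

Definition fg_map (X Y : choiceType) (f : X -> Y) :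
    {multiplicative free_group X -> free_group Y} :=
  fg_lift (fun x => fg_gen (f x)).

Lemma fg_map_gen (X Y : choiceType) (f : X -> Y) x :
  fg_map f (fg_gen x) = fg_gen (f x).
Proof. exact: fg_lift_gen. Qed.

Record presentation : Type := Presentation {
  gens : choiceType;
  rels : choiceType;
  relator : rels -> free_group gens
}.

Record finite_subpresentation (P : presentation) : Type := FiniteSubpresentation {
  sub_gens : {fset gens P};
  sub_rels : {fset rels P};
  sub_relP : forall y : sub_rels,
    exists u : free_group sub_gens, fg_map val u == relator (val y)
}.

(* The witness chosen below is unique, since Phi(X_1) -> Phi(X) is injective. *)
Definition subpresentation (P : presentation) (S : finite_subpresentation P) :
    presentation :=
  @Presentation (sub_gens S) (sub_rels S) (fun y => xchoose (sub_relP y)).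

Section PresentationComplex.
Variables (R : realType) (P : presentation).

(* The 2-cells are modelled on the closed unit square.  A point of the
   complex is the 0-cell or a point of exactly one open cell. *)
Inductive precell : Type :=
  | Cell0
  | Cell1 of gens P & R
  | Cell2 of rels P & R & R.

Definition in_open_cell (p : precell) : bool :=
  match p with
  | Cell0 => true
  | Cell1 _ s => 0 < s < 1
  | Cell2 _ s t => (0 < s < 1) && (0 < t < 1)
  end.

Record presentation_complex : Type :=
  Complex { cell_of :> precell; _ : in_open_cell cell_of }.

HB.instance Definition _ := [isSub for cell_of].
HB.instance Definition _ := gen_eqMixin presentation_complex.
HB.instance Definition _ := gen_choiceMixin presentation_complex.

Definition base : presentation_complex := @Complex Cell0 isT.

(* Characteristic map of the 1-cell x on [0, 1]; both ends go to base. *)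
Definition char1 (x : gens P) (s : R) : presentation_complex :=
  insubd base (Cell1 x s).

(* The loop on [0, 1] that traverses the n letters of w in order, each on an
   interval of length 1/n; an inverse letter traverses its 1-cell backwards. *)
Definition word_loop (w : seq (letter (gens P))) (s : R) : presentation_complex :=
  let u := s * (size w)%:R in
  let k := Num.truncn u in
  if onth w k is Some (x, b)
  then char1 x (if b then u - k%:R else 1 - (u - k%:R))
  else base.

(* Characteristic map of the 2-cell y on [0, 1] x [0, 1]: the edge t = 0 runs
   along the relator and the other three edges go to base. *)
Definition char2 (y : rels P) (st : R * R) : presentation_complex :=
  if st.2 == 0 then word_loop (word (relator y)) st.1
  else insubd base (Cell2 y st.1 st.2).

(* Weak topology: a set is open when its preimage in every closed cell is. *)
Definition complex_open (U : set presentation_complex) : Prop :=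
  (forall x, open (char1 x @^-1` U : set (subspace `[0, 1]))) /\
  (forall y, open (char2 y @^-1` U : set (subspace (`[0, 1] `*` `[0, 1])))).

Lemma complex_openT : complex_open setT.
Proof. by split=> ?; rewrite preimage_setT; exact: openT. Qed.

Lemma complex_openI : setI_closed complex_open.
Proof.
move=> A B [A1 A2] [B1 B2].
by split=> z; rewrite preimage_setI; apply: openI.
Qed.

Lemma complex_open_bigcup (I : Type) (f : I -> set presentation_complex) :
  (forall i, complex_open (f i)) -> complex_open (\bigcup_i f i).
Proof.
move=> fo; split=> z; rewrite preimage_bigcup; apply: bigcup_open => i _.
- exact: (fo i).1.
- exact: (fo i).2.
Qed.

HB.instance Definition _ := isOpenTopological.Build presentation_complex
  complex_openT complex_openI complex_open_bigcup.

End PresentationComplex.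

Definition contractible (R : realType) (T : topologicalType) : Prop :=
  exists (p : T) (H : T * R -> T),
    [/\ {within [set: T] `*` `[0, 1], continuous H},
        forall x, H (x, 0) = x
      & forall x, H (x, 1) = p].

Definition contractible_presentation (R : realType) (P : presentation) : Prop :=
  contractible R (presentation_complex R P).

Record category : Type := Category {
  obj :> Type;
  hom : obj -> obj -> Type;
  idc : forall A, hom A A;
  comp : forall A B C, hom B C -> hom A B -> hom A C;
  comp_idl : forall A B (f : hom A B), comp (idc B) f = f;
  comp_idr : forall A B (f : hom A B), comp f (idc A) = f;
  comp_assoc : forall A B C D (f : hom A B) (g : hom B C) (h : hom C D),
    comp h (comp g f) = comp (comp h g) f
}.
Arguments hom {c}.
Arguments idc {c}.
Arguments comp {c A B C}.

Notation "g \oc f" := (comp g f) (at level 40, left associativity).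

(* An index i of 'I_n seen in 'I_n.+1 with value i, resp. i + 1. *)
Definition widen {n} (i : 'I_n) : 'I_n.+1 := lift ord_max i.
Definition shift {n} (i : 'I_n) : 'I_n.+1 := lift ord0 i.

Lemma widenE n (i : 'I_n) : widen i = i :> nat.
Proof. exact: lift_max. Qed.

Lemma shiftE n (i : 'I_n) : shift i = i.+1 :> nat.
Proof. exact: lift0. Qed.

(* The three identities between faces and degeneracies are those for
   i < j, i = j or j + 1, and i > j + 1; below, they and the homotopy identities
   are indexed so that every index is in range. *)
Record simplicial (C : category) : Type := Simplicial {
  lev :> nat -> C;
  face : forall n, 'I_n.+2 -> hom (lev n.+1) (lev n);
  dgn : forall n, 'I_n.+1 -> hom (lev n) (lev n.+1);
  face_face : forall n (i j : 'I_n.+2), (i <= j)%N ->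
    @face n i \oc @face n.+1 (shift j) = @face n j \oc @face n.+1 (widen i);
  dgn_dgn : forall n (i j : 'I_n.+1), (i <= j)%N ->
    @dgn n.+1 (widen i) \oc @dgn n j = @dgn n.+1 (shift j) \oc @dgn n i;
  face_dgn_lt : forall n (i : 'I_n.+2) (j : 'I_n.+1), (i <= j)%N ->
    @face n.+1 (widen i) \oc @dgn n.+1 (shift j) = @dgn n j \oc @face n i;
  face_dgn_eq : forall n (j : 'I_n.+1),
    @face n (widen j) \oc @dgn n j = idc (lev n);
  face_dgn_eqS : forall n (j : 'I_n.+1),
    @face n (shift j) \oc @dgn n j = idc (lev n);
  face_dgn_gt : forall n (i : 'I_n.+2) (j : 'I_n.+1), (j < i)%N ->
    @face n.+1 (shift i) \oc @dgn n.+1 (widen j) = @dgn n j \oc @face n i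
}.
Arguments face {C} s {n}.
Arguments dgn {C} s {n}.

Section SimplicialMaps.
Variable C : category.

Record simplicial_map (A B : simplicial C) : Type := SimplicialMap {
  at_lev :> forall n, hom (A n) (B n);
  map_face : forall n (i : 'I_n.+2),
    face B i \oc at_lev n.+1 = at_lev n \oc face A i;
  map_dgn : forall n (i : 'I_n.+1),
    dgn B i \oc at_lev n = at_lev n.+1 \oc dgn A i
}.

Lemma id_map_face (A : simplicial C) n (i : 'I_n.+2) :
  face A i \oc idc (A n.+1) = idc (A n) \oc face A i.
Proof. by rewrite comp_idl comp_idr. Qed.

Lemma id_map_dgn (A : simplicial C) n (i : 'I_n.+1) :
  dgn A i \oc idc (A n) = idc (A n.+1) \oc dgn A i.
Proof. by rewrite comp_idl comp_idr. Qed.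

Definition simplicial_id (A : simplicial C) : simplicial_map A A :=
  @SimplicialMap A A (fun n => idc (A n)) (@id_map_face A) (@id_map_dgn A).

Section Composition.
Variables (A B D : simplicial C).
Variables (g : simplicial_map B D) (f : simplicial_map A B).

Lemma comp_map_face n (i : 'I_n.+2) :
  face D i \oc (g n.+1 \oc f n.+1) = (g n \oc f n) \oc face A i.
Proof. by rewrite comp_assoc map_face -!comp_assoc map_face. Qed.

Lemma comp_map_dgn n (i : 'I_n.+1) :
  dgn D i \oc (g n \oc f n) = (g n.+1 \oc f n.+1) \oc dgn A i.
Proof. by rewrite comp_assoc map_dgn -!comp_assoc map_dgn. Qed.

Definition simplicial_comp : simplicial_map A D :=
  @SimplicialMap A D (fun n => g n \oc f n) comp_map_face comp_map_dgn.

End Composition.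

Definition const_simplicial (G : C) : simplicial C :=
  @Simplicial C (fun=> G) (fun _ _ => idc G) (fun _ _ => idc G)
    (fun _ _ _ _ => erefl) (fun _ _ _ _ => erefl) (fun _ _ _ _ => erefl)
    (fun _ _ => comp_idl (idc G)) (fun _ _ => comp_idl (idc G))
    (fun _ _ _ _ => erefl).

(* The convention is d_0 h_0 = f and d_(n+1) h_n = g. *)
Record simplicial_homotopy (A B : simplicial C) (f g : simplicial_map A B) :
    Type := SimplicialHomotopy {
  htpy : forall n, 'I_n.+1 -> hom (A n) (B n.+1);
  htpy_start : forall n, face B ord0 \oc @htpy n ord0 = f n;
  htpy_end : forall n, face B ord_max \oc @htpy n ord_max = g n;
  face_htpy_lt : forall n (i : 'I_n.+2) (j : 'I_n.+1), (i <= j)%N ->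
    face B (widen i) \oc @htpy n.+1 (shift j) = @htpy n j \oc face A i;
  face_htpy_eq : forall n (j : 'I_n.+1),
    face B (shift (widen j)) \oc @htpy n.+1 (shift j)
    = face B (shift (widen j)) \oc @htpy n.+1 (widen j);
  face_htpy_gt : forall n (i : 'I_n.+2) (j : 'I_n.+1), (j < i)%N ->
    face B (shift i) \oc @htpy n.+1 (widen j) = @htpy n j \oc face A i;
  dgn_htpy_le : forall n (i j : 'I_n.+1), (i <= j)%N ->
    dgn B (widen i) \oc @htpy n j = @htpy n.+1 (shift j) \oc dgn A i;
  dgn_htpy_gt : forall n (i j : 'I_n.+1), (j <= i)%N ->
    dgn B (shift i) \oc @htpy n j = @htpy n.+1 (widen j) \oc dgn A i
}.

End SimplicialMaps.

Lemma multiplicative_ext (G H : groupType) (f g : {multiplicative G -> H}) :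
  f =1 g -> f = g.
Proof.
case: f g => f [[fM]] [g [[gM]]] /= /funext e; subst g.
by rewrite (Prop_irrelevance fM gM).
Qed.

Lemma group_comp_idl (G H : groupType) (f : {multiplicative G -> H}) :
  (idfun \o f : {multiplicative G -> H}) = f.
Proof. exact: multiplicative_ext. Qed.

Lemma group_comp_idr (G H : groupType) (f : {multiplicative G -> H}) :
  (f \o idfun : {multiplicative G -> H}) = f.
Proof. exact: multiplicative_ext. Qed.

Lemma group_comp_assoc (G H K L : groupType) (f : {multiplicative G -> H})
    (g : {multiplicative H -> K}) (h : {multiplicative K -> L}) :
  (h \o (g \o f : {multiplicative G -> K}) : {multiplicative G -> L})
  = ((h \o g : {multiplicative H -> L}) \o f : {multiplicative G -> L}).
Proof. exact: multiplicative_ext. Qed.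

Definition group_cat : category :=
  @Category groupType (fun G H => {multiplicative G -> H})
    (fun G => (idfun : {multiplicative G -> G}))
    (fun G H K g f => (g \o f : {multiplicative G -> K}))
    group_comp_idl group_comp_idr group_comp_assoc.

Section FreeSimplicialGroup.
Variable P : presentation.

(* The degeneracies of y in degree n are the y o theta for the monotone
   surjections theta : [n] -> [1]; theta is given by the number k of vertices it
   sends to 0, 1 <= k <= n, and (y, i) is the one with k = i + 1. *)
Definition simplex_gens (n : nat) : choiceType := (gens P + rels P * 'I_n)%type.

(* The value of y o theta for a monotone theta : [n] -> [1] sending k vertices
   to 0.  Since d_0 y = 1 and d_1 y = r_y, it is 1 for theta constant at 1
   (k = 0), and r_y for theta constant at 0 (k = n + 1). *)
Definition simplex_rel (n : nat) (y : rels P) (k : nat) :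
    free_group (simplex_gens n) :=
  if k is k'.+1 then
    if insub k' is Some i then fg_gen (inr (y, i) : simplex_gens n)
    else fg_map (fun x => inl x : simplex_gens n) (relator y)
  else 1%g.

(* Restriction of theta along the i-th coface, resp. codegeneracy. *)
Definition fsg_face (n : nat) (i : 'I_n.+2) :
    {multiplicative free_group (simplex_gens n.+1) ->
                    free_group (simplex_gens n)} :=
  fg_lift (fun z : simplex_gens n.+1 =>
    match z with
    | inl x => fg_gen (inl x : simplex_gens n)
    | inr (y, k) => simplex_rel n y (k.+1 - (i < k.+1)%N)
    end).

Definition fsg_dgn (n : nat) (i : 'I_n.+1) :
    {multiplicative free_group (simplex_gens n) ->
                    free_group (simplex_gens n.+1)} :=
  fg_lift (fun z : simplex_gens n =>
    match z with
    | inl x => fg_gen (inl x : simplex_gens n.+1)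
    | inr (y, k) => simplex_rel n.+1 y (k.+1 + (i < k.+1)%N)
    end).

Lemma fsg_face_inl n (i : 'I_n.+2) x :
  fsg_face i (fg_gen (inl x : simplex_gens n.+1))
  = fg_gen (inl x : simplex_gens n).
Proof. exact: fg_lift_gen. Qed.

Lemma fsg_face_inr n (i : 'I_n.+2) y (k : 'I_n.+1) :
  fsg_face i (fg_gen (inr (y, k) : simplex_gens n.+1))
  = simplex_rel n y (k.+1 - (i < k.+1)%N).
Proof. exact: fg_lift_gen. Qed.

Lemma fsg_dgn_inl n (i : 'I_n.+1) x :
  fsg_dgn i (fg_gen (inl x : simplex_gens n))
  = fg_gen (inl x : simplex_gens n.+1).
Proof. exact: fg_lift_gen. Qed.

Lemma fsg_dgn_inr n (i : 'I_n.+1) y (k : 'I_n) :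
  fsg_dgn i (fg_gen (inr (y, k) : simplex_gens n))
  = simplex_rel n.+1 y (k.+1 + (i < k.+1)%N).
Proof. exact: fg_lift_gen. Qed.

Lemma fsg_face_rel n (i : 'I_n.+2) y k : (k <= n.+2)%N ->
  fsg_face i (simplex_rel n.+1 y k) = simplex_rel n y (k - (i < k)%N).
Proof.
case: k => [|k] kn; first exact: multiplicative1.
rewrite {1}/simplex_rel; case: insubP => [j _ <-|]; first by rewrite fsg_face_inr.
rewrite -leqNgt => nk; have {nk}ek : k = n.+1 by apply/eqP; rewrite eqn_leq nk andbT.
rewrite ek ltn_ord subn1 /= insubF ?ltnn //.
apply: (fg_hom_ext (h := fsg_face i \o fg_map _)) => x /=.
by rewrite !fg_map_gen fsg_face_inl.
Qed.

Lemma fsg_dgn_rel n (i : 'I_n.+1) y k : (k <= n.+1)%N ->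
  fsg_dgn i (simplex_rel n y k) = simplex_rel n.+1 y (k + (i < k)%N).
Proof.
case: k => [|k] kn; first exact: multiplicative1.
rewrite {1}/simplex_rel; case: insubP => [j _ <-|]; first by rewrite fsg_dgn_inr.
rewrite -leqNgt => nk; have {nk}ek : k = n by apply/eqP; rewrite eqn_leq nk andbT.
rewrite ek ltn_ord addn1 /= insubF ?ltnn //.
apply: (fg_hom_ext (h := fsg_dgn i \o fg_map _)) => x /=.
by rewrite !fg_map_gen fsg_dgn_inl.
Qed.

Lemma simplex_relS n y (k : 'I_n) :
  simplex_rel n y k.+1 = fg_gen (inr (y, k) : simplex_gens n).
Proof. by rewrite /simplex_rel valK. Qed.

Lemma fsg_ext n (G : groupType)
    (h k : {multiplicative free_group (simplex_gens n) -> G}) :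
  (forall x, h (fg_gen (inl x : simplex_gens n))
             = k (fg_gen (inl x : simplex_gens n))) ->
  (forall y (i : nat), (0 < i <= n)%N ->
     h (simplex_rel n y i) = k (simplex_rel n y i)) -> h = k.
Proof.
move=> hx hy; apply/multiplicative_ext/fg_hom_ext => -[x|[y i]]; first exact: hx.
by rewrite -simplex_relS; apply: hy; exact: ltn_ord.
Qed.

Definition fsg_lev (n : nat) : group_cat := free_group (simplex_gens n).
Definition fsg_faceC n (i : 'I_n.+2) : hom (fsg_lev n.+1) (fsg_lev n) :=
  fsg_face i.
Definition fsg_dgnC n (i : 'I_n.+1) : hom (fsg_lev n) (fsg_lev n.+1) :=
  fsg_dgn i.

Lemma fsg_face_face n (i j : 'I_n.+2) : (i <= j)%N ->
  fsg_faceC i \oc fsg_faceC (shift j) = fsg_faceC j \oc fsg_faceC (widen i).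
Proof.
move=> ij; apply: fsg_ext => [x|y k kn];
  rewrite -[LHS]/(fsg_face i (fsg_face (shift j) _))
    -[RHS]/(fsg_face j (fsg_face (widen i) _));
  first by rewrite ?(fsg_face_inl, fsg_dgn_inl).
by rewrite !fsg_face_rel ?shiftE ?widenE; [congr simplex_rel|..]; lia.
Qed.

Lemma fsg_dgn_dgn n (i j : 'I_n.+1) : (i <= j)%N ->
  fsg_dgnC (widen i) \oc fsg_dgnC j = fsg_dgnC (shift j) \oc fsg_dgnC i.
Proof.
move=> ij; apply: fsg_ext => [x|y k kn];
  rewrite -[LHS]/(fsg_dgn (widen i) (fsg_dgn j _))
    -[RHS]/(fsg_dgn (shift j) (fsg_dgn i _));
  first by rewrite ?(fsg_face_inl, fsg_dgn_inl).
by rewrite !fsg_dgn_rel ?shiftE ?widenE; [congr simplex_rel|..]; lia.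
Qed.

Lemma fsg_face_dgn_lt n (i : 'I_n.+2) (j : 'I_n.+1) : (i <= j)%N ->
  fsg_faceC (widen i) \oc fsg_dgnC (shift j) = fsg_dgnC j \oc fsg_faceC i.
Proof.
move=> ij; apply: fsg_ext => [x|y k kn];
  rewrite -[LHS]/(fsg_face (widen i) (fsg_dgn (shift j) _))
    -[RHS]/(fsg_dgn j (fsg_face i _));
  first by rewrite ?(fsg_face_inl, fsg_dgn_inl).
by rewrite fsg_dgn_rel 2?fsg_face_rel ?fsg_dgn_rel ?shiftE ?widenE;
   [congr simplex_rel|..]; lia.
Qed.

Lemma fsg_face_dgn_eq n (j : 'I_n.+1) :
  fsg_faceC (widen j) \oc fsg_dgnC j = idc (fsg_lev n).
Proof.
apply: fsg_ext => [x|y k kn];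
  rewrite -[LHS]/(fsg_face (widen j) (fsg_dgn j _));
  first by rewrite ?(fsg_face_inl, fsg_dgn_inl).
by rewrite fsg_dgn_rel 1?fsg_face_rel ?widenE; [congr simplex_rel|..]; lia.
Qed.

Lemma fsg_face_dgn_eqS n (j : 'I_n.+1) :
  fsg_faceC (shift j) \oc fsg_dgnC j = idc (fsg_lev n).
Proof.
apply: fsg_ext => [x|y k kn];
  rewrite -[LHS]/(fsg_face (shift j) (fsg_dgn j _));
  first by rewrite ?(fsg_face_inl, fsg_dgn_inl).
by rewrite fsg_dgn_rel 1?fsg_face_rel ?shiftE; [congr simplex_rel|..]; lia.
Qed.

Lemma fsg_face_dgn_gt n (i : 'I_n.+2) (j : 'I_n.+1) : (j < i)%N ->
  fsg_faceC (shift i) \oc fsg_dgnC (widen j) = fsg_dgnC j \oc fsg_faceC i.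
Proof.
move=> ij; apply: fsg_ext => [x|y k kn];
  rewrite -[LHS]/(fsg_face (shift i) (fsg_dgn (widen j) _))
    -[RHS]/(fsg_dgn j (fsg_face i _));
  first by rewrite ?(fsg_face_inl, fsg_dgn_inl).
by rewrite fsg_dgn_rel 2?fsg_face_rel ?fsg_dgn_rel ?shiftE ?widenE;
   [congr simplex_rel|..]; lia.
Qed.

Definition free_simplicial_group : simplicial group_cat :=
  @Simplicial group_cat fsg_lev fsg_faceC fsg_dgnC
    fsg_face_face fsg_dgn_dgn fsg_face_dgn_lt fsg_face_dgn_eq
    fsg_face_dgn_eqS fsg_face_dgn_gt.

Lemma fsg_face0 (y : rels P) :
  fsg_face (ord0 : 'I_2) (fg_gen (inr (y, ord0) : simplex_gens 1)) = 1%g.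
Proof. by rewrite fsg_face_inr. Qed.

Lemma fsg_face1 (y : rels P) :
  fsg_face (ord_max : 'I_2) (fg_gen (inr (y, ord0) : simplex_gens 1))
  = fg_map (fun x => inl x : simplex_gens 0) (relator y).
Proof. by rewrite fsg_face_inr /= insubF. Qed.

End FreeSimplicialGroup.

(* An affine group scheme is a representable functor from commutative
   Q-algebras to groups: a commutative Q-algebra A with a group structure on
   Hom(A, B), natural in B.  Compatibility of the unit and of the inverse with
   base change follows from that of the product.  The zero ring, over which
   there is a unique point, is not a comAlgType. *)
Record affine_group : Type := AffineGroup {
  coord : comAlgType rat;
  pt_mul : forall B : comAlgType rat,
    {lrmorphism coord -> B} -> {lrmorphism coord -> B} -> {lrmorphism coord -> B};
  pt_one : forall B : comAlgType rat, {lrmorphism coord -> B};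
  pt_inv : forall B : comAlgType rat,
    {lrmorphism coord -> B} -> {lrmorphism coord -> B};
  pt_mulA : forall B, associative (@pt_mul B);
  pt_mul1 : forall B, left_id (pt_one B) (@pt_mul B);
  pt_mulr1 : forall B, right_id (pt_one B) (@pt_mul B);
  pt_mulV : forall B, left_inverse (pt_one B) (@pt_inv B) (@pt_mul B);
  pt_mulrV : forall B, right_inverse (pt_one B) (@pt_inv B) (@pt_mul B);
  pt_mul_natural : forall (B C : comAlgType rat) (u : {lrmorphism B -> C})
      (p q : {lrmorphism coord -> B}),
    (u \o pt_mul p q : {lrmorphism coord -> C})
    = pt_mul (u \o p : {lrmorphism coord -> C}) (u \o q : {lrmorphism coord -> C})
}.

Definition points (G : affine_group) (B : comAlgType rat) : Type :=
  {lrmorphism coord G -> B}.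

Section Points.
Variables (G : affine_group) (B : comAlgType rat).
HB.instance Definition _ := gen_eqMixin (points G B).
HB.instance Definition _ := gen_choiceMixin (points G B).
HB.instance Definition _ := isGroup.Build (points G B)
  (@pt_mulA G B) (@pt_mul1 G B) (@pt_mulr1 G B) (@pt_mulV G B) (@pt_mulrV G B).
End Points.

Definition base_change (G : affine_group) (B C : comAlgType rat)
    (u : {lrmorphism B -> C}) (p : points G B) : points G C :=
  (u \o (p : {lrmorphism coord G -> B}) : {lrmorphism coord G -> C}).

Definition generic_point (G : affine_group) : points G (coord G) :=
  (idfun : {lrmorphism coord G -> coord G}).

Definition pull (G H : affine_group) (f : {lrmorphism coord H -> coord G})
    (B : comAlgType rat) (p : points G B) : points H B :=
  ((p : {lrmorphism coord G -> B}) \o f : {lrmorphism coord H -> B}).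

(* By Yoneda, a morphism of affine group schemes is given by its comorphism. *)
Record gs_hom (G H : affine_group) : Type := GsHom {
  comorphism : {lrmorphism coord H -> coord G};
  comorphismM : forall B : comAlgType rat,
    {morph @pull G H comorphism B : p q / (p * q)%g}
}.

Definition on_points (G H : affine_group) (f : gs_hom G H) (B : comAlgType rat)
    (p : points G B) : points H B := pull (comorphism f) p.

HB.instance Definition _ (G H : affine_group) (f : gs_hom G H)
    (B : comAlgType rat) :=
  isMultiplicative.Build (points G B) (points H B) (@on_points G H f B)
    (@comorphismM G H f B).

Lemma lrmorphism_ext (A B : comAlgType rat) (f g : {lrmorphism A -> B}) :
  f =1 g -> f = g.
Proof.
case: f g => f [[fa] [fm] [fs]] [g [[ga] [gm] [gs]]] /= /funext e; subst g.
by rewrite (Prop_irrelevance fa ga) (Prop_irrelevance fm gm)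
           (Prop_irrelevance fs gs).
Qed.

Lemma gs_hom_ext (G H : affine_group) (f g : gs_hom G H) :
  comorphism f =1 comorphism g -> f = g.
Proof.
case: f g => f fM [g gM] /= /lrmorphism_ext e; subst g.
by congr GsHom; exact: Prop_irrelevance.
Qed.

Lemma pull_idM (G : affine_group) (B : comAlgType rat) :
  {morph @pull G G (idfun : {lrmorphism coord G -> coord G}) B
    : p q / (p * q)%g}.
Proof.
have pull_id (p : points G B) :
  pull (idfun : {lrmorphism coord G -> coord G}) p = p.
  exact: lrmorphism_ext.
by move=> p q; rewrite !pull_id.
Qed.

Definition gs_id (G : affine_group) : gs_hom G G := GsHom (@pull_idM G).

Lemma pull_compM (G H K : affine_group) (g : gs_hom H K) (f : gs_hom G H)
    (B : comAlgType rat) :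
  {morph @pull G K (comorphism f \o comorphism g
                      : {lrmorphism coord K -> coord G}) B : p q / (p * q)%g}.
Proof.
have pull_comp (p : points G B) :
  pull (comorphism f \o comorphism g : {lrmorphism coord K -> coord G}) p
  = on_points g (on_points f p).
  exact: lrmorphism_ext.
by move=> p q; rewrite !pull_comp !gmulfM.
Qed.

Definition gs_comp (G H K : affine_group) (g : gs_hom H K) (f : gs_hom G H) :
    gs_hom G K := GsHom (@pull_compM G H K g f).

(* G is isomorphic to a closed subgroup of the group U_n of upper unitriangular
   matrices: there are homomorphisms G(B) -> U_n(B), natural in B, such that
   O(U_n) -> O(G) is surjective, i.e. such that the matrix entries of the
   generic point generate O(G). *)
Definition unipotent (G : affine_group) : Prop :=
  exists (n : nat) (rho : forall B : comAlgType rat, points G B -> 'M[B]_n),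
    [/\ forall B p q, rho B (p * q)%g = rho B p *m rho B q,
        forall (B C : comAlgType rat) (u : {lrmorphism B -> C}) (p : points G B),
          rho C (base_change u p) = map_mx u (rho B p),
        forall B p (i j : 'I_n), (j <= i)%N -> rho B p i j = (i == j)%:R
      & forall S : {pred coord G}, GRing.subalg_closed S ->
          (forall i j, rho _ (generic_point G) i j \in S) ->
          forall a, a \in S].

Record inverse_system : Type := InverseSystem {
  idx : Type;
  idx_le : idx -> idx -> Prop;
  idx_inh : inhabited idx;
  idx_refl : forall i, idx_le i i;
  idx_trans : forall i j k, idx_le i j -> idx_le j k -> idx_le i k;
  idx_directed : forall i j, exists k, idx_le i k /\ idx_le j k;
  term : idx -> affine_group;
  transition : forall i j, idx_le i j -> gs_hom (term j) (term i);
  transition_id : forall i (h : idx_le i i), transition h = gs_id (term i);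
  transition_comp : forall i j k (h1 : idx_le i j) (h2 : idx_le j k)
      (h : idx_le i k),
    gs_comp (transition h1) (transition h2) = transition h
}.

(* Limits of affine group schemes are computed on points. *)
Definition is_inverse_limit (U : inverse_system) (G : affine_group)
    (pr : forall i : idx U, gs_hom G (term i)) : Prop :=
  (forall (i j : idx U) (h : idx_le i j),
     gs_comp (transition h) (pr j) = pr i) /\
  (forall (B : comAlgType rat) (p : forall i : idx U, points (term i) B),
     (forall (i j : idx U) (h : idx_le i j),
        on_points (transition h) (p j) = p i) ->
     exists! q : points G B, forall i, on_points (pr i) q = p i).

Definition prounipotent (G : affine_group) : Prop :=
  exists (U : inverse_system) (pr : forall i : idx U, gs_hom G (term i)),
    (forall i : idx U, unipotent (term i)) /\ is_inverse_limit pr.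

Record prounipotent_group : Type := ProunipotentGroup {
  scheme :> affine_group;
  schemeP : prounipotent scheme
}.

Lemma gs_comp_idl (G H : prounipotent_group) (f : gs_hom G H) :
  gs_comp (gs_id H) f = f.
Proof. exact: gs_hom_ext. Qed.

Lemma gs_comp_idr (G H : prounipotent_group) (f : gs_hom G H) :
  gs_comp f (gs_id G) = f.
Proof. exact: gs_hom_ext. Qed.

Lemma gs_comp_assoc (G H K L : prounipotent_group) (f : gs_hom G H)
    (g : gs_hom H K) (h : gs_hom K L) :
  gs_comp h (gs_comp g f) = gs_comp (gs_comp h g) f.
Proof. exact: gs_hom_ext. Qed.

Definition prounipotent_cat : category :=
  @Category prounipotent_group gs_hom gs_id gs_comp
    gs_comp_idl gs_comp_idr gs_comp_assoc.

Definition rational_points (G : affine_group) : groupType := points G rat^o.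

Definition zariski_dense (D : groupType) (G : affine_group)
    (eta : {multiplicative D -> rational_points G}) : Prop :=
  forall a : coord G,
    (forall d : D, (eta d : {lrmorphism coord G -> rat^o}) a = 0) -> a = 0.

Definition is_prounipotent_completion (D : groupType) (G : prounipotent_group)
    (eta : {multiplicative D -> rational_points G}) : Prop :=
  zariski_dense eta /\
  forall (H : prounipotent_group) (phi : {multiplicative D -> rational_points H}),
    exists! f : gs_hom G H, forall d : D, on_points f (eta d) = phi d.

Definition is_degreewise_completion (A : simplicial group_cat)
    (hA : simplicial prounipotent_cat)
    (eta : forall n, {multiplicative (A n : groupType) ->
                      rational_points (hA n : prounipotent_group)}) : Prop :=
  [/\ forall n, is_prounipotent_completion (eta n),
      forall n (i : 'I_n.+2) (a : (A n.+1 : groupType)),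
        eta n ((face A i : {multiplicative _ -> _}) a)
        = on_points (face hA i : gs_hom _ _) (eta n.+1 a)
    & forall n (i : 'I_n.+1) (a : (A n : groupType)),
        eta n.+1 ((dgn A i : {multiplicative _ -> _}) a)
        = on_points (dgn hA i : gs_hom _ _) (eta n a)].

(* Main.v *)
Require Import Defs.
From HB Require Import structures.
From mathcomp Require Import all_boot all_order all_algebra finmap.
From mathcomp Require Import all_classical all_reals.
From mathcomp Require Import topology normedtype interval_inference.
From mathcomp Require Import zify ring lra.

(* Contractibility makes the relators linearly independent.  Fix y0 and label the
   points of K = K(X | Y) by 0, 1, 2 on three closed regions that meet only at
   the centre of the 2-cell y0, and by 3 elsewhere; no point is a limit of all
   four labels.  For a contraction H, the map (s, s', t) |-> H(y(s, s'), t) on a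
   fine grid of the unit cube then omits a label on every small cube, so the
   signed number of small boundary squares with labels 0, 1, 2 around them
   vanishes.  The face t = 0 contributes 1 if y = y0 and 0 otherwise, the face
   along the relator contributes the sum over its letters of +-phi(x), where
   phi(x) is the number for the square (s, t) |-> H(x(s), t), and the other faces
   contribute 0.  Hence -phi is a cochain equal to delta_{y0} on the relators.

   Rationally invertible exponents make a word map bijective.  On the rational
   points of a unipotent group inside the unitriangular matrices, modulo the
   (k+1)-st superdiagonal a word map changes by its exponent matrix when its
   arguments change on the k-th one, and rational powers exist by polynomial
   interpolation; Newton iteration along the superdiagonals concludes.  The
   prounipotent case follows by passing to the limit.

   So in the completion of P_0 the relators, completed by generators indexed by
   Z, form another free basis, and P_n gets a basis consisting of Z and of the
   y o theta for the monotone theta : [n] -> [1] taking the value 0.  In this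
   basis P is Const on Z times a cone, contracted by theta |-> max(theta, sigma)
   for sigma in Delta^1. *)

Set Implicit Arguments.
Unset Strict Implicit.
Unset Printing Implicit Defensive.

Import Order.TTheory GRing.Theory Num.Theory.
Import numFieldNormedType.Exports.

Local Open Scope classical_set_scope.
Local Open Scope ring_scope.

(* Both names are shadowed by mathcomp.algebra.vector. *)
Local Notation coord := Defs.coord.
Local Notation hom := Defs.hom.

(** * Contractible presentations *)

(** The 1-cochain on the simplex of labels dual to the oriented edge from 0 to 1. *)
Definition step01 (a b : nat) : int :=
  ((a == 0%N) && (b == 1%N))%:Z - ((a == 1%N) && (b == 0%N))%:Z.

(* On labels avoiding 3 this is the coboundary of [step01], and it vanishes on
   labels avoiding 0, 1 or 2: it is a cocycle on cubes that avoid one label. *)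
Definition circ (a b c d : nat) : int :=
  if 3%N \in [:: a; b; c; d] then 0
  else step01 a b + step01 b c + step01 c d + step01 d a.

Lemma step01C a b : step01 b a = - step01 a b.
Proof. by rewrite /step01; do 2 case: (a == _); do 2 case: (b == _). Qed.

Lemma circ_rev a b c d : circ d c b a = - circ a b c d.
Proof.
rewrite /circ; have -> : (3%N \in [:: d; c; b; a]) = (3%N \in [:: a; b; c; d]).
  by rewrite !inE; do 4 case: eqP => _.
case: ifP => _; first by rewrite oppr0.
by rewrite (step01C a) (step01C d a) (step01C c d) (step01C b c); ring.
Qed.

Lemma circ_degenerate a b : circ a b b a = 0.
Proof. by have := circ_rev a b b a; lia. Qed.

(** Without the label 3, [circ] adds [step01] around a closed path. If 0 or 1 is missing, no step
    counts; if 2 is missing, the path runs to and fro along one edge and its steps cancel. *)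
Lemma circ_miss l a b c d : (l < 3)%N ->
  all (fun x => (x <= 3)%N && (x != l)) [:: a; b; c; d] -> circ a b c d = 0.
Proof.
move=> l3 /= /and5P[/andP[a3 al] /andP[b3 bl] /andP[c3 cl] /andP[d3 dl] _].
rewrite /circ; case: ifP => //; move: l3 a3 al b3 bl c3 cl d3 dl.
case: l => [|[|[|//]]] _; case: a => [|[|[|[|//]]]] // _ _;
case: b => [|[|[|[|//]]]] // _ _;
case: c => [|[|[|[|//]]]] // _ _; case: d => [|[|[|[|//]]]] // _ _.
Qed.

(** For l < 3 every face vanishes by [circ_miss]. For l = 3 every face is a coboundary, and each
    edge of the cube lies on two faces that traverse it in opposite directions. *)
Lemma circ_cube l (v : bool -> bool -> bool -> nat) : (l <= 3)%N ->
  (forall a b c, (v a b c <= 3)%N && (v a b c != l)) ->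
    (circ (v true false false) (v true true false)
          (v true true true) (v true false true)
     - circ (v false false false) (v false true false)
            (v false true true) (v false false true))
  + (circ (v false true false) (v false true true)
          (v true true true) (v true true false)
     - circ (v false false false) (v false false true)
            (v true false true) (v true false false))
  + (circ (v false false true) (v true false true)
          (v true true true) (v false true true)
     - circ (v false false false) (v true false false)
            (v true true false) (v false true false)) = 0.
Proof.
move=> l3 H.
have [l3'|l3'] := ltnP l 3; first by rewrite !(circ_miss l3') /= ?H.
have {l3 l3'}el : l = 3%N by apply/eqP; rewrite eqn_leq l3.
have N3 a b c d : 3%N != a -> 3%N != b -> 3%N != c -> 3%N != d ->
    circ a b c d = step01 a b + step01 b c + step01 c d + step01 d a.
  by rewrite /circ !inE => /negPf-> /negPf-> /negPf-> /negPf->.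
have H3 a b c : 3%N != v a b c.
  by have /andP[_] := H a b c; rewrite el eq_sym.
rewrite !N3 ?H3 //.
(* Each of the twelve edges is written in one direction only, so that its two occurrences cancel. *)
have E a b c a' b' c' :
    step01 (v a b c) (v a' b' c') = - step01 (v a' b' c') (v a b c).
  exact: step01C.
rewrite ?(E false false false true false false) ?(E false false false false true false).
rewrite ?(E false false false false false true) ?(E true false false true true false).
rewrite ?(E true false false true false true) ?(E false true false true true false).
rewrite ?(E false true false false true true) ?(E false false true true false true).
rewrite ?(E false false true false true true) ?(E true true false true true true).
rewrite ?(E true false true true true true) ?(E false true true true true true).
ring.
Qed.

(** * Summation over a grid of cubes *)

Section Grid.
Variables (f : nat -> nat -> nat -> nat) (L M T : nat).
Hypothesis f_miss : forall i j k, (i < L)%N -> (j < M)%N -> (k < T)%N ->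
  exists2 l, (l <= 3)%N & forall a b c : bool,
     (f (i + a) (j + b) (k + c) <= 3)%N && (f (i + a)%N (j + b)%N (k + c)%N != l).

Definition face1 i j k := circ (f i j k) (f i j.+1 k) (f i j.+1 k.+1) (f i j k.+1).
Definition face2 i j k := circ (f i j k) (f i j k.+1) (f i.+1 j k.+1) (f i.+1 j k).
Definition face3 i j k := circ (f i j k) (f i.+1 j k) (f i.+1 j.+1 k) (f i j.+1 k).

(** The identity [circ_cube], summed over all small cubes, telescopes in each direction and leaves
    the outer faces. *)
Lemma grid_boundary :
    \sum_(0 <= j < M) \sum_(0 <= k < T) (face1 L j k - face1 0%N j k)
  + \sum_(0 <= i < L) \sum_(0 <= k < T) (face2 i M k - face2 i 0%N k)
  + \sum_(0 <= i < L) \sum_(0 <= j < M) (face3 i j T - face3 i j 0%N) = 0.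
Proof.
have cube i j k : (i < L)%N -> (j < M)%N -> (k < T)%N ->
    (face1 i.+1 j k - face1 i j k) + (face2 i j.+1 k - face2 i j k)
    + (face3 i j k.+1 - face3 i j k) = 0.
  move=> iL jM kT; have [l l3 H] := f_miss iL jM kT.
  have := circ_cube (v := fun a b c : bool => f (i + a) (j + b) (k + c)) l3 H.
  by rewrite !addn1 !addn0.
transitivity (\sum_(0 <= i < L) \sum_(0 <= j < M) \sum_(0 <= k < T)
    ((face1 i.+1 j k - face1 i j k) + (face2 i j.+1 k - face2 i j k)
    + (face3 i j k.+1 - face3 i j k))); last first.
  rewrite big_nat big1// => i iL; rewrite big_nat big1// => j jM.
  by rewrite big_nat big1// => k kT; apply: cube.
have -> : \sum_(0 <= i < L) \sum_(0 <= j < M) \sum_(0 <= k < T)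
    ((face1 i.+1 j k - face1 i j k) + (face2 i j.+1 k - face2 i j k)
    + (face3 i j k.+1 - face3 i j k))
  = \sum_(0 <= i < L) \sum_(0 <= j < M) \sum_(0 <= k < T) (face1 i.+1 j k - face1 i j k)
  + \sum_(0 <= i < L) \sum_(0 <= j < M) \sum_(0 <= k < T) (face2 i j.+1 k - face2 i j k)
  + \sum_(0 <= i < L) \sum_(0 <= j < M) \sum_(0 <= k < T) (face3 i j k.+1 - face3 i j k).
  rewrite -!big_split; apply: eq_bigr => i _; rewrite -!big_split; apply: eq_bigr => j _.
  by rewrite -!big_split.
congr (_ + _ + _).
- rewrite [RHS]exchange_big /=; apply: eq_bigr => j _.
  by rewrite [RHS]exchange_big /=; apply: eq_bigr => k _; rewrite telescope_sumr.
- apply: eq_bigr => i _; rewrite [RHS]exchange_big /=; apply: eq_bigr => k _.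
  by rewrite telescope_sumr.
- by apply: eq_bigr => i _; apply: eq_bigr => j _; rewrite telescope_sumr.
Qed.

End Grid.

(** * A labelling of the presentation complex *)

Section Labels.
Variables (R : realType) (P : presentation) (y0 : rels P).
Notation K := (presentation_complex R P).
Implicit Types (W : set (R * R)) (q : K).

Definition open_square : set (R * R) := [set st | 0 < st.1 < 1 /\ 0 < st.2 < 1].

Definition cell_set W : set K :=
  [set q | exists2 st, W st & cell_of q = Cell2 y0 st.1 st.2].

Lemma cell_of_word_loop (w : seq (letter (gens P))) (s : R) y a b :
  cell_of (word_loop w s) <> Cell2 y a b.
Proof.
rewrite /word_loop; case: onth => [[x c]|//].
by rewrite /char1 /insubd; case: insubP => [q _ ->|].
Qed.

Lemma char2_open (y : rels P) (st : R * R) : open_square st ->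
  cell_of (char2 y st) = Cell2 y st.1 st.2.
Proof.
move=> [/andP[s0 s1] /andP[t0 t1]]; rewrite /char2 gt_eqF// /insubd.
by rewrite insubT ?SubK //= s0 s1 t0 t1.
Qed.

Lemma cell_of_char2 (y : rels P) (st : R * R) y' a b :
  cell_of (char2 y st) = Cell2 y' a b -> [/\ y = y', st.1 = a & st.2 = b].
Proof.
rewrite /char2; case: ifP => _; first by move/cell_of_word_loop.
by rewrite /insubd; case: insubP => [q _ ->|_]//= [].
Qed.

Lemma char1_cell_set x W : char1 x @^-1` cell_set W = set0.
Proof.
rewrite -subset0 => s [st _]; rewrite /char1 /insubd.
by case: insubP => [q _ ->|].
Qed.

Lemma char2_cell_set (y : rels P) W : W `<=` open_square ->
  char2 y @^-1` cell_set W = if y == y0 then W else set0.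
Proof.
move=> Wo; apply/seteqP; split=> [st [[a b] Wab /cell_of_char2[/= -> sa tb]]|st].
  by rewrite eqxx; case: st sa tb => [? ?] /= -> ->.
case: eqP => // -> Wst; exists st => //; exact/char2_open/Wo.
Qed.

(** In the weak topology only the preimages in the closed cells matter; they are empty, except for W
    in the cell y0. *)
Lemma cell_set_open W : open W -> W `<=` open_square -> open (cell_set W).
Proof.
move=> oW Wo; split=> z; first by rewrite char1_cell_set; exact: open0.
rewrite char2_cell_set//; case: eqP => _; last exact: open0.
exact: open_subspaceW.
Qed.

Lemma cell_set_closed W : closed W -> W `<=` open_square -> open (~` cell_set W).
Proof.
move=> cW Wo; split=> z.
  have -> : char1 z @^-1` (~` cell_set W) = setT.
    by rewrite -setC0 -(char1_cell_set z W).
  exact: openT.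
have -> : char2 z @^-1` (~` cell_set W) = if z == y0 then ~` W else setT.
  have := congr1 (@setC _) (char2_cell_set z Wo); rewrite -preimage_setC => ->.
  by case: ifP; rewrite ?setC0.
case: eqP => _; last exact: openT.
by apply: open_subspaceW; exact: closed_openC.
Qed.

Definition label_square (s t : R) : nat :=
  if (1/4 <= s <= 3/4) && (1/4 <= t <= 3/4) then
    if s < 1/2 then 0%N else if t < 1/2 then 1%N else 2%N
  else 3%N.

Definition label q : nat :=
  if cell_of q is Cell2 y s t then if y == y0 then label_square s t else 3%N
  else 3%N.

Lemma label_le3 q : (label q <= 3)%N.
Proof.
rewrite /label; case: (cell_of q) => // y s t; case: ifP => // _.
by rewrite /label_square; do 3 case: ifP => //.
Qed.

(** Contains the points that [label_square] labels l. For l = 0, 1, 2 the regions have only the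
    centre (1/2, 1/2) in common. *)
Definition closed_region (l : nat) : set (R * R) :=
  [set st | [/\ 1/4 <= st.1 <= 3/4, 1/4 <= st.2 <= 3/4 &
    match l with
    | 0%N => st.1 <= 1/2
    | 1%N => 1/2 <= st.1 /\ st.2 <= 1/2
    | _ => 1/2 <= st.1 /\ 1/2 <= st.2
    end]].

Lemma closed_region_open_square l : closed_region l `<=` open_square.
Proof. by move=> [s t] [/= sQ tQ _]; split=> /=; lra. Qed.

Let fst_cont : continuous (@fst R R).
Proof. by move=> p; exact: (@cvg_fst _ _ (nbhs p.1) (nbhs p.2)). Qed.
Let snd_cont : continuous (@snd R R).
Proof. by move=> p; exact: (@cvg_snd _ _ (nbhs p.1) (nbhs p.2)). Qed.

Lemma closed_fst_ge (c : R) : closed [set st : R * R | c <= st.1].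
Proof.
exact: (@preimage_closed (R * R)%type R fst [set x | c <= x] (fun p _ => @fst_cont p)
  (@closed_ge _ c)).
Qed.
Lemma closed_fst_le (c : R) : closed [set st : R * R | st.1 <= c].
Proof.
exact: (@preimage_closed (R * R)%type R fst [set x | x <= c] (fun p _ => @fst_cont p)
  (@closed_le _ c)).
Qed.
Lemma closed_snd_ge (c : R) : closed [set st : R * R | c <= st.2].
Proof.
exact: (@preimage_closed (R * R)%type R snd [set x | c <= x] (fun p _ => @snd_cont p)
  (@closed_ge _ c)).
Qed.
Lemma closed_snd_le (c : R) : closed [set st : R * R | st.2 <= c].
Proof.
exact: (@preimage_closed (R * R)%type R snd [set x | x <= c] (fun p _ => @snd_cont p)
  (@closed_le _ c)).
Qed.

Lemma closed_region_closed l : closed (closed_region l).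
Proof.
have cQ : closed (([set st : R * R | 1/4 <= st.1] `&` [set st | st.1 <= 3/4])
    `&` ([set st | 1/4 <= st.2] `&` [set st | st.2 <= 3/4])).
  do !apply: closedI; [exact: closed_fst_ge|exact: closed_fst_le
    |exact: closed_snd_ge|exact: closed_snd_le].
have -> : closed_region l =
    (([set st : R * R | 1/4 <= st.1] `&` [set st | st.1 <= 3/4])
    `&` ([set st | 1/4 <= st.2] `&` [set st | st.2 <= 3/4])) `&`
    match l with
    | 0%N => [set st : R * R | st.1 <= 1/2]
    | 1%N => [set st : R * R | 1/2 <= st.1] `&` [set st | st.2 <= 1/2]
    | _ => [set st : R * R | 1/2 <= st.1] `&` [set st | 1/2 <= st.2]
    end.
  apply/seteqP; split=> -[s t] /=.
    by move=> [/andP[? ?] /andP[? ?]]; case: l => [|[|?]].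
  move=> [[[a b] [c d]] e]; split; [exact/andP|exact/andP|].
  by case: l e => [|[|?]].
apply: closedI => //; case: l => [|[|?]]; first exact: closed_fst_le.
  by apply: closedI; [exact: closed_fst_ge|exact: closed_snd_le].
by apply: closedI; [exact: closed_fst_ge|exact: closed_snd_ge].
Qed.

Lemma label_lt3 q l : (l < 3)%N -> label q = l -> cell_set (closed_region l) q.
Proof.
move=> l3; rewrite /label; case e : (cell_of q) => [|?|y s t];
  [by move=> E; rewrite -E in l3..|].
case: eqP => [ey|_]; last by move=> E; rewrite -E in l3.
subst y; rewrite /label_square; case: ifP => [/andP[sQ tQ]|_];
  last by move=> E; rewrite -E in l3.
move=> E; exists (s, t) => //; split=> //=; rewrite -{}E {l3}.
by case: ltP => ? /=; [exact: ltW|case: ltP => ? /=; split=> //; exact: ltW].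
Qed.

(** Near a point of the open middle square of y0 the label 3 is absent. Any other point lies outside
    one of the three closed regions, whose complement is then a neighbourhood without the
    corresponding label. *)
Lemma label_locally_misses q :
  exists l O, [/\ (l <= 3)%N, open O, O q & forall q', O q' -> label q' <> l].
Proof.
pose Q : set (R * R) := [set st | 1/4 < st.1 < 3/4 /\ 1/4 < st.2 < 3/4].
have oQ : open Q.
  have -> : Q = ~` ([set st : R * R | st.1 <= 1/4] `|` [set st | 3/4 <= st.1]
     `|` [set st | st.2 <= 1/4] `|` [set st | 3/4 <= st.2]).
    rewrite !setCU; apply/seteqP; split=> -[s t] /=.
      by move=> [/andP[a b] /andP[c d]]; do !split; apply/negP; rewrite -ltNge.
    move=> [[[/negP a /negP b] /negP c] /negP d]; rewrite -!ltNge in a b c d.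
    by split; apply/andP.
  by apply: closed_openC; do !apply: closedU; [exact: closed_fst_le
     |exact: closed_fst_ge|exact: closed_snd_le|exact: closed_snd_ge].
have QS : Q `<=` open_square by move=> [s t] [/= ? ?]; split=> /=; lra.
have [inQ|ninQ] := pselect (cell_set Q q).
  exists 3%N, (cell_set Q); split=> //; first exact: cell_set_open.
  move=> q' [[s t] [/= ? ?]]; rewrite /label => ->; rewrite eqxx /label_square.
  by rewrite ifT; [do 2 case: ifP => //|lra].
(* A point of all three regions would be the centre of y0, which lies in the middle square. *)
have [l l3 nl] : exists2 l, (l < 3)%N & ~ cell_set (closed_region l) q.
  apply: contrapT => /forall2NP H.
  have {}H l : (l < 3)%N -> cell_set (closed_region l) q.
    by move=> l3; case: (H l) => // /contrapT.
  have [[s t] [/= s0 t0 h0] e0] := H 0%N isT.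
  have [[s1 t1] [/= _ _ [h1 h1']]] := H 1%N isT; rewrite e0 => -[e1 e1'].
  have [[s2 t2] [/= _ _ [h2 h2']]] := H 2%N isT; rewrite e0 => -[e2 e2'].
  by apply: ninQ; exists (s, t) => //; subst; split=> /=; lra.
exists l, (~` cell_set (closed_region l)); split=> //; first exact: ltnW.
  apply: cell_set_closed; [exact: closed_region_closed|exact: closed_region_open_square].
by move=> q' + e; apply; exact: label_lt3.
Qed.

Definition cube : set (R * R * R) := `[0, 1] `*` `[0, 1] `*` `[0, 1].

Lemma cube_compact : compact cube.
Proof. by do 2?apply: compact_setX; exact: segment_compact. Qed.

(** A Lebesgue number argument on the compact cube. The radius is twice the mesh, so that
    neighbouring grid points lie in the open ball. *)
Lemma label_uniformly_misses (f : R * R * R -> K) :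
    (forall p (O : set K), cube p -> open O -> O (f p) ->
       \forall p' \near p, cube p' -> O (f p')) ->
  exists N0, forall N, (N0 <= N)%N -> forall p, cube p ->
    exists2 l, (l <= 3)%N & forall p', cube p' -> ball p (N.+1%:R^-1 *+ 2) p' ->
       label (f p') <> l.
Proof.
move=> fc; pose good (N : nat) p := exists2 l, (l <= 3)%N & forall p', cube p' ->
   ball p (N.+1%:R^-1 *+ 2) p' -> label (f p') <> l.
have : \forall N \near \oo, cube `<=` good N.
  have /compact_near_coveringP := cube_compact; apply=> p cp.
  have [l [O [l3 oO Op ml]]] := label_locally_misses (f p).
  have /nbhs_ballP[e /= e0 be] := fc _ _ cp oO Op.
  (* The radius 2/(N+1) is then below e/2, so the ball around p' stays inside the ball of radius e
     around p. *)
  exists (ball p (e / 2), [set N | N.+1%:R^-1 < e / 4]) => /=.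
    split; first by apply: nbhsx_ballx; rewrite divr_gt0.
    by apply: (near_infty_natSinv_lt (PosNum (divr_gt0 e0 (ltr0Sn _ 3)))).
  move=> [p' N] [/= pp' Ne]; exists l => // p'' cp'' bp''.
  apply: ml; apply: be => //; apply: ball_split pp' (le_ball _ bp'').
  by move: (N.+1%:R^-1) Ne => u; rewrite -mulr_natr; lra.
by case=> N0 _ H; exists N0 => N /H; apply.
Qed.

End Labels.

(** * The degree of the labelling on a square *)

Section SquareDegree.
Variables q m : nat.
Hypotheses (q_gt0 : (0 < q)%N) (m_gt0 : (0 < m)%N).

(** The labelling of the unit square sampled on 4q by 4m small squares; the lines at 1/4, 1/2 and
    3/4 belong to this grid. *)
Definition grid_label (i j : nat) : nat :=
  if (q <= i <= 3 * q)%N && (m <= j <= 3 * m)%N then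
    if (i < 2 * q)%N then 0%N else if (j < 2 * m)%N then 1%N else 2%N
  else 3%N.

(** Only the square with lowest corner (2q-1, 2m-1) carries all of 0, 1, 2. Squares left of its
    column miss 1 and those right of it miss 0; within the column, the squares below miss 2 and
    those above miss 1. *)
Lemma circ_grid_label i j :
  circ (grid_label i j) (grid_label i.+1 j) (grid_label i.+1 j.+1) (grid_label i j.+1)
  = ((i == (2 * q).-1) && (j == (2 * m).-1))%:Z.
Proof.
have lab_le i' j' : (grid_label i' j' <= 3)%N.
  by rewrite /grid_label; do 3 case: ifP => //.
have lab0 i' j' : (2 * q <= i')%N -> grid_label i' j' != 0%N.
  by rewrite /grid_label; move=> h; rewrite (ltnNge i') h /=; do 2 case: ifP => //.
have lab1 i' j' : (i' < 2 * q)%N || (2 * m <= j')%N -> grid_label i' j' != 1%N.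
  rewrite /grid_label (leqNgt (2 * m)); case: ifP => // _.
  by case: (i' < _)%N => //= /negPf->.
have lab2 i' j' : (i' < 2 * q)%N || (j' < 2 * m)%N -> grid_label i' j' != 2%N.
  by rewrite /grid_label; case: ifP => // _; case: (i' < _)%N => //= ->.
case: eqP => [ei|ni] /=; last first.
  have [iq|iq] := ltnP i (2 * q).
    have iq' : (i.+1 < 2 * q)%N by lia.
    by apply: (@circ_miss 1) => //=; rewrite !lab_le !lab1 ?iq ?iq'.
  by apply: (@circ_miss 0) => //=; rewrite !lab_le !lab0 // (leq_trans iq).
case: eqP => [ej|nj] /=; last first.
  have [jm|jm] := ltnP j (2 * m).
    have jm' : (j.+1 < 2 * m)%N by lia.
    by apply: (@circ_miss 2) => //=; rewrite !lab_le !lab2 ?jm ?jm' ?orbT.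
  by apply: (@circ_miss 1) => //=; rewrite !lab_le !lab1 ?jm ?(leq_trans jm) ?orbT.
rewrite /grid_label.
have -> : (q <= i <= 3 * q)%N by lia. have -> : (q <= i.+1 <= 3 * q)%N by lia.
have -> : (m <= j <= 3 * m)%N by lia. have -> : (m <= j.+1 <= 3 * m)%N by lia.
have -> : (i < 2 * q)%N by lia. have -> : (i.+1 < 2 * q)%N = false by lia.
have -> : (j < 2 * m)%N by lia. have -> : (j.+1 < 2 * m)%N = false by lia.
by [].
Qed.

Lemma grid_label_degree :
  \sum_(0 <= i < 4 * q) \sum_(0 <= j < 4 * m)
    circ (grid_label i j) (grid_label i.+1 j) (grid_label i.+1 j.+1) (grid_label i j.+1)
  = 1.
Proof.
rewrite (eq_bigr (fun i => ((i == (2 * q).-1) && true)%:Z)); last first.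
  move=> i _; rewrite (eq_bigr _ (fun j _ => circ_grid_label i j)).
  case: eqP => _ /=; last by rewrite big1.
  rewrite (bigD1_seq (2 * m).-1) ?mem_index_iota ?iota_uniq /=; [|lia|by []].
  by rewrite eqxx big1// => j /negPf->.
rewrite (bigD1_seq (2 * q).-1) ?mem_index_iota ?iota_uniq /=; [|lia|by []].
by rewrite eqxx big1// => i /negPf->.
Qed.

Lemma label_square_grid (R : realType) i j :
  label_square (i%:R / (4 * q)%:R : R) (j%:R / (4 * m)%:R) = grid_label i j.
Proof.
have le1 (c k r : nat) : (0 < r)%N ->
    (c%:R / 4%:R <= k%:R / (4 * r)%:R :> R) = (c * r <= k)%N.
  move=> r0; have r0' : (0 : R) < r%:R by rewrite ltr0n.
  rewrite ler_pdivlMr ?ltr0n ?muln_gt0 ?r0// natrM mulrA divfK ?pnatr_eq0//.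
  by rewrite -natrM ler_nat.
have le2 (c k r : nat) : (0 < r)%N ->
    (k%:R / (4 * r)%:R <= c%:R / 4%:R :> R) = (k <= c * r)%N.
  move=> r0; have r0' : (0 : R) < r%:R by rewrite ltr0n.
  rewrite ler_pdivrMr ?ltr0n ?muln_gt0 ?r0// natrM mulrA divfK ?pnatr_eq0//.
  by rewrite -natrM ler_nat.
have half : (1 / 2 : R) = 2%:R / 4%:R by lra.
rewrite /label_square /grid_label half !ltNge.
by rewrite -[1 / 4 :> R]/(1%:R / 4%:R) !le1 ?le2 // !mul1n -!ltnNge.
Qed.

End SquareDegree.

(** * The characteristic map on the boundary of a 2-cell *)

Section WordLoop.
Variables (R : realType) (P : presentation).
Implicit Types (w : seq (letter (gens P))).

Definition traverse (a : letter (gens P)) (s : R) : presentation_complex R P :=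
  char1 a.1 (if a.2 then s else 1 - s).

Lemma char1_0 (x : gens P) : char1 x (0 : R) = base R P.
Proof. by rewrite /char1 /insubd insubF //= ltxx. Qed.

Lemma char1_1 (x : gens P) : char1 x (1 : R) = base R P.
Proof. by rewrite /char1 /insubd insubF //= ltxx andbF. Qed.

Lemma traverse1 a : traverse a 1 = base R P.
Proof. by rewrite /traverse; case: a.2; rewrite ?subrr ?char1_0 ?char1_1. Qed.

(** At i = N the truncation moves on to the next letter; that case is left to [word_loop_nat]. *)
Lemma word_loop_at w (i N : nat) (s : R) (k : nat) a :
  s * (size w)%:R = k%:R + i%:R / N%:R -> (i < N)%N -> onth w k = Some a ->
  word_loop w s = traverse a (i%:R / N%:R).
Proof.
move=> su iN wk; have N0 : (0 : R) < N%:R by rewrite ltr0n (leq_ltn_trans _ iN).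
rewrite /word_loop su.
have -> : Num.truncn (k%:R + i%:R / N%:R : R) = k.
  apply/eqP; rewrite Num.Theory.truncn_eq ?addr_ge0 ?divr_ge0 ?ler0n//.
  by rewrite lerDl divr_ge0 //= -natr1 ltrD2l ltr_pdivrMr// mul1r ltr_nat.
by rewrite wk addrAC subrr add0r; case: a {wk} => x [].
Qed.

Lemma word_loop_nat w (s : R) (k : nat) :
  s * (size w)%:R = k%:R -> word_loop w s = base R P.
Proof.
move=> su; rewrite /word_loop su natrK subrr subr0; case: onth => [[x b]|//].
by case: b; rewrite ?char1_0 ?char1_1.
Qed.

Lemma char2_left (y : rels P) (t : R) : char2 y (0, t) = base R P.
Proof.
rewrite /char2 /=; case: eqP => _; first by apply: (@word_loop_nat _ _ 0); rewrite mul0r.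
by rewrite /insubd insubF //= ltxx.
Qed.

Lemma char2_right (y : rels P) (t : R) : char2 y (1, t) = base R P.
Proof.
rewrite /char2 /=; case: eqP => _.
  by apply: (@word_loop_nat _ _ (size (word (relator y)))); rewrite mul1r.
by rewrite /insubd insubF //= ltxx andbF.
Qed.

Lemma char2_top (y : rels P) (s : R) : char2 y (s, 1) = base R P.
Proof. by rewrite /char2 /= oner_eq0 /insubd insubF //= ltxx !andbF. Qed.

Lemma char2_bottom (y : rels P) (s : R) :
  char2 y (s, 0) = word_loop (word (relator y)) s.
Proof. by rewrite /char2 /= eqxx. Qed.

Lemma label_char2 y0 (y : rels P) (s t : R) :
  label y0 (char2 y (s, t)) = if y == y0 then label_square s t else 3%N.
Proof.
have [[s01 t01]|nst] := pselect (open_square (s, t)).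
  by rewrite /label char2_open.
have -> : label y0 (char2 y (s, t)) = 3%N.
  rewrite /label; case e : cell_of => [|//|y' a b] //.
  move: e; rewrite /char2; case: ifP => _; first by move/cell_of_word_loop.
  rewrite /insubd; case: insubP => [q + ->|_]//= => /[swap] -[_ _ _].
  by move=> /andP[? ?]; case: nst.
case: ifP => // _; rewrite /label_square ifF //; apply/negP => /andP[? ?].
by apply: nst; split=> /=; lra.
Qed.

End WordLoop.

Definition letter_sum (X : choiceType) (V : zmodType) (phi : X -> V)
    (w : seq (letter X)) : V :=
  \sum_(a <- w) (if a.2 then phi a.1 else - phi a.1).

Lemma letter_sumN (X : choiceType) (V : zmodType) (phi : X -> V)
    (w : seq (letter X)) :
  letter_sum (fun x => - phi x) w = - letter_sum phi w.
Proof. by rewrite /letter_sum -sumrN; apply: eq_bigr => a _; case: a.2. Qed.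

(** * Degrees of a contraction on the cells *)

Section Contraction.
Variables (R : realType) (P : presentation) (y0 : rels P).
Notation K := (presentation_complex R P).
Variables (p0 : K) (H : K * R -> K).
Hypotheses (H_cont : {within [set: K] `*` `[0, 1], continuous H})
  (H0 : forall x, H (x, 0) = x) (H1 : forall x, H (x, 1) = p0).

(** The weak topology makes [char2 y] continuous on the closed square, and [H] is continuous for
    times in [0, 1]. *)
Lemma contraction_cell_continuous (y : rels P) (p : R * R * R) (O : set K) :
    cube p -> open O -> O (H (char2 y p.1, p.2)) ->
  \forall p' \near p, cube p' -> O (H (char2 y p'.1, p'.2)).
Proof.
move: p => [st t] [/= st01 t01] oO Op.
have At : ([set: K] `*` `[0, 1]) (char2 y st, t) by [].
have /subspace_continuousP/(_ _ At) Hc := H_cont.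
have /= := Hc O (open_nbhs_nbhs (conj oO Op)).
case=> -[U V] /= [/nbhs_interior Uq Vt] UV.
have oU : open U° by exact: open_interior.
have [_ /(_ y)/open_subspaceP[W oW WE]] := oU.
have Wst : W st.
  have : (W `&` (`[0, 1] `*` `[0, 1])) st.
    by rewrite WE; split=> //; exact: nbhs_singleton Uq.
  by case.
exists (W, V) => /=; first by split=> //; exact: open_nbhs_nbhs.
move=> [st' t'] /= [Wst' Vt'] [st01' t01'].
apply: (UV (char2 y st', t')) => //; split=> //=; apply: interior_subset.
have : (W `&` (`[0, 1] `*` `[0, 1])) st' by [].
by rewrite WE => -[].
Qed.

Section Grid.
Variables (N : nat).
Hypothesis N_gt0 : (0 < N)%N.

Definition square_label (x : gens P) (b k : nat) : nat :=
  label y0 (H (char1 x (b%:R / N%:R), k%:R / N%:R)).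

(** The signed number of squares with labels 0, 1, 2 swept out by the 1-cell x under the homotopy;
    up to sign, the value at x of the cochain sought. *)
Definition homotopy_degree (x : gens P) : int :=
  \sum_(0 <= b < N) \sum_(0 <= k < N)
    circ (square_label x b k) (square_label x b k.+1)
         (square_label x b.+1 k.+1) (square_label x b.+1 k).

Definition traverse_label (a : letter (gens P)) (b k : nat) : nat :=
  label y0 (H (traverse a (b%:R / N%:R), k%:R / N%:R)).

(** An inverse letter runs through the grid backwards, which reverses the orientation of every
    square. *)
Lemma traverse_degree a :
  \sum_(0 <= b < N) \sum_(0 <= k < N)
    circ (traverse_label a b k) (traverse_label a b k.+1)
         (traverse_label a b.+1 k.+1) (traverse_label a b.+1 k)
  = if a.2 then homotopy_degree a.1 else - homotopy_degree a.1.
Proof.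
case: a => x [] //=; rewrite big_nat_rev /= add0n /homotopy_degree -sumrN.
rewrite !big_nat; apply: eq_bigr => b /= bN; rewrite -sumrN; apply: eq_bigr => k _.
have e c k' : (c <= N)%N -> traverse_label (x, false) (N - c) k' = square_label x c k'.
  move=> cN; rewrite /traverse_label /square_label /traverse /=.
  congr (label _ (H (char1 _ _, _))).
  have N0 : N%:R != 0 :> R by rewrite pnatr_eq0 -lt0n.
  by rewrite natrB// mulrBl divff// opprB addrC subrK.
by rewrite -subSn // subSS !e ?(ltnW bN) // circ_rev.
Qed.

Variable y : rels P.
Let w := word (relator y).
(** The maximum keeps the grid nonempty, and its mesh defined, for an empty relator. *)
Let n := maxn (size w) 1.

Definition cube_label (i j k : nat) : nat :=
  label y0 (H (char2 y (i%:R / (n * N)%:R, j%:R / N%:R), k%:R / N%:R)).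

(** The edge along the relator has N grid steps for each letter, so this face is a row of blocks,
    one per letter. *)
Lemma side_degree :
  \sum_(0 <= i < n * N) \sum_(0 <= k < N) face2 cube_label i 0 k
  = letter_sum homotopy_degree w.
Proof.
have N0 : N%:R != 0 :> R by rewrite pnatr_eq0 -lt0n.
have [w0|w_gt0] := posnP (size w).
  rewrite /letter_sum (size0nil w0) big_nil big1// => i _; rewrite big1// => k _.
  have e i' k' : cube_label i' 0 k' = label y0 (H (base R P, k'%:R / N%:R)).
    rewrite /cube_label mul0r char2_bottom (word_loop_nat (k := 0))//.
    by rewrite -/w w0 mulr0.
  by rewrite /face2 !e circ_degenerate.
have nE : n = size w by apply/maxn_idPl.
have a0 : letter (gens P) by case: (w) w_gt0.
have e a b k : (a < size w)%N -> (b <= N)%N ->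
    cube_label (a * N + b) 0 k = traverse_label (nth a0 w a) b k.
  move=> aw bN; rewrite /cube_label /traverse_label mul0r char2_bottom.
  congr (label _ (H (_, _))).
  have n0 : (size w)%:R != 0 :> R by rewrite pnatr_eq0 -lt0n.
  have su : (a * N + b)%:R / (n * N)%:R * (size w)%:R = a%:R + b%:R / N%:R :> R.
    by rewrite nE natrD !natrM; field; rewrite n0 N0.
  (* At the end b = N of a letter, the word loop and the path of the letter are both at the
     0-cell. *)
  move: bN; rewrite leq_eqVlt => /predU1P[eb|bN].
    rewrite eb in su *; rewrite divff// traverse1; apply: (@word_loop_nat _ _ _ _ a.+1).
    by rewrite su divff// natr1.
  by apply: word_loop_at su bN _; rewrite onthE (nth_map a0).
rewrite nE big_nat_mul /letter_sum (big_nth a0) !big_nat.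
apply: eq_bigr => a /= aw; rewrite -traverse_degree.
rewrite -{1}[(a * N)%N]add0n big_addn mulSn addnK !big_nat; apply: eq_bigr => b bN.
by apply: eq_bigr => k _; rewrite /face2 addnC -addnS !e // ltnW.
Qed.

(** At time 0 the homotopy is the identity, so the squares of the 2-cell itself are counted.
    Divisibility by 4 puts the borders between labels on the grid. *)
Lemma face3_bottom_degree m q : N = (4 * m)%N -> (n * N = 4 * q)%N ->
  \sum_(0 <= i < n * N) \sum_(0 <= j < N) face3 cube_label i j 0 = (y == y0)%:Z.
Proof.
move=> Nm nNq.
have e i j : cube_label i j 0
    = if y == y0 then label_square (i%:R / (n * N)%:R : R) (j%:R / N%:R) else 3%N.
  by rewrite /cube_label mul0r H0 label_char2.
have n_gt0 : (0 < n)%N by rewrite /n leq_max orbT.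
have m0 : (0 < m)%N by lia.
have q0 : (0 < q)%N.
  by rewrite -(@ltn_pmul2l 4) // muln0 -nNq muln_gt0 n_gt0.
case: eqP e => [_|_] e /=; last first.
  by rewrite big1// => i _; rewrite big1// => j _; rewrite /face3 !e.
rewrite -[RHS](grid_label_degree q0 m0) nNq Nm.
apply: eq_bigr => i _; apply: eq_bigr => j _.
by rewrite /face3 !e nNq Nm !label_square_grid.
Qed.

(** In [grid_boundary] the left and right faces cancel, the faces on the top edge and at time 1
    consist of degenerate squares, and the side along the relator balances the face at time 0. *)
Lemma homotopy_degree_relator m : N = (4 * m)%N ->
    (forall p, cube p -> exists2 l, (l <= 3)%N & forall p', cube p' ->
       ball p (N%:R^-1 *+ 2) p' -> label y0 (H (char2 y p'.1, p'.2)) <> l) ->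
  letter_sum homotopy_degree w = - (y == y0)%:Z.
Proof.
move=> Nm miss.
have N0 : N%:R != 0 :> R by rewrite pnatr_eq0 -lt0n.
have n_gt0 : (0 < n)%N by rewrite /n leq_max orbT.
have nN0 : (n * N)%:R != 0 :> R by rewrite pnatr_eq0 -lt0n muln_gt0 n_gt0.
pose c k := label y0 (H (base R P, k%:R / N%:R)).
have left j k : cube_label 0 j k = c k by rewrite /cube_label mul0r char2_left.
have right j k : cube_label (n * N) j k = c k by rewrite /cube_label divff// char2_right.
have top i k : cube_label i N k = c k by rewrite /cube_label divff// char2_top.
have end_ i j : cube_label i j N = label y0 p0 by rewrite /cube_label divff// H1.
have grid := @grid_boundary cube_label (n * N) N N _.
have {grid} : forall i j k, (i < n * N)%N -> (j < N)%N -> (k < N)%N ->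
  exists2 l, (l <= 3)%N & forall a b c : bool,
     (cube_label (i + a) (j + b) (k + c) <= 3)%N
     && (cube_label (i + a)%N (j + b)%N (k + c)%N != l).
  move=> i j k iL jN kN.
  have frac01 (u M : nat) : (u <= M)%N -> 0 <= (u%:R / M%:R : R) <= 1.
    move=> uM; rewrite divr_ge0 ?ler0n//=; have [->|M0] := posnP M.
      by rewrite invr0 mulr0.
    by rewrite ler_pdivrMr ?ltr0n// mul1r ler_nat.
  have cubeP i' j' k' : (i' <= n * N)%N -> (j' <= N)%N -> (k' <= N)%N ->
      cube (i'%:R / (n * N)%:R : R, j'%:R / N%:R : R, k'%:R / N%:R : R).
    by move=> ? ? ?; do !split; rewrite /= in_itv /= frac01.
  have [l l3 ml] := miss _ (cubeP i j k (ltnW iL) (ltnW jN) (ltnW kN)).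
  exists l => // a b d; rewrite label_le3; apply/eqP.
  apply: (ml (_%:R / _%:R, _%:R / _%:R, _%:R / _%:R)).
    by apply: cubeP; [case: a|case: b|case: d]; lia.
  (* A grid step is at most 1/N in every direction, also along the relator, where it is 1/(nN). *)
  have near_frac (u M : nat) (e : bool) : (0 < M)%N -> (N <= M)%N ->
      ball (u%:R / M%:R : R) (N%:R^-1 *+ 2) ((u + e)%:R / M%:R).
    move=> M0 NM; rewrite -ball_normE /= natrD mulrDl opprD addrA subrr add0r normrN.
    have M0' : (0 : R) < M%:R by rewrite ltr0n.
    have N0' : (0 : R) < N%:R by rewrite ltr0n.
    rewrite ger0_norm ?divr_ge0 ?ler0n//; apply: (@le_lt_trans _ _ (N%:R^-1)).
      apply: (@le_trans _ _ (M%:R^-1)); last by rewrite lef_pV2// ler_nat.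
      by rewrite ler_piMl ?invr_ge0 ?ler0n//; case: e; rewrite ?ler01.
    by rewrite mulr2n ltrDl invr_gt0.
  do !split; apply: near_frac => //; first by rewrite muln_gt0 n_gt0.
  by rewrite leq_pmull.
move/grid_boundary.
rewrite big1; last first.
  by move=> j _; rewrite big1// => k _; rewrite /face1 !left !right subrr.
rewrite add0r.
under eq_bigr => i _.
  under eq_bigr => k _ do rewrite [face2 cube_label i N k]/face2 !top circ_degenerate sub0r.
  rewrite sumrN; over.
rewrite sumrN side_degree.
under eq_bigr => i _.
  under eq_bigr => j _ do rewrite [face3 cube_label i j N]/face3 !end_ circ_degenerate sub0r.
  rewrite sumrN; over.
have nN4 : (n * N = 4 * (n * m))%N by rewrite Nm mulnCA.
rewrite sumrN (face3_bottom_degree Nm nN4) -opprD => /eqP.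
by rewrite oppr_eq0 addr_eq0 => /eqP.
Qed.

End Grid.
End Contraction.

(** The cochain depends on the grid; for a finite list of relators one grid is fine enough for all
    of them. *)
Lemma contractible_relators_independent (R : realType) (P : presentation)
    (y0 : rels P) (ys : seq (rels P)) : contractible_presentation R P ->
  exists phi : gens P -> int, forall y, y \in ys ->
    letter_sum phi (word (relator y)) = (y == y0)%:Z.
Proof.
move=> [p0 [H [Hc H0 H1]]].
have /choice[N0 HN0] := fun y => label_uniformly_misses y0
  (fun p O => @contraction_cell_continuous _ _ H Hc y p O).
pose m := (\max_(y <- ys) N0 y).+1.
exists (fun x => - homotopy_degree y0 H (4 * m) x) => y yys.
rewrite letter_sumN -[RHS]opprK; congr (- _).
apply: (homotopy_degree_relator (N := 4 * m) H0 H1 _ (erefl _)) => // p cp.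
have Ny : (N0 y <= (4 * m).-1)%N.
  have : (N0 y < m)%N by rewrite ltnS; exact: leq_bigmax_seq.
  by move: (m) => M; lia.
have := HN0 y _ Ny p cp.
by rewrite prednK.
Qed.

(** * Word maps on prounipotent groups *)


Section SuperdiagonalFiltration.
Variables (F : comNzRingType) (n : nat).
Implicit Types A B : 'M[F]_n.

Definition superdiag (k : nat) A : Prop :=
  forall i j : 'I_n, (j < i + k)%N -> A i j = 0.

Lemma superdiag0 k : superdiag k 0.
Proof. by move=> i j _; rewrite mxE. Qed.

Lemma superdiagD k A B : superdiag k A -> superdiag k B -> superdiag k (A + B).
Proof. by move=> hA hB i j ij; rewrite mxE hA ?hB ?addr0. Qed.

Lemma superdiagN k A : superdiag k A -> superdiag k (- A).
Proof. by move=> hA i j ij; rewrite mxE hA ?oppr0. Qed.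

Lemma superdiagB k A B : superdiag k A -> superdiag k B -> superdiag k (A - B).
Proof. by move=> hA hB; apply/superdiagD/superdiagN. Qed.

Lemma superdiagZ k c A : superdiag k A -> superdiag k (c *: A).
Proof. by move=> hA i j ij; rewrite mxE hA ?mulr0. Qed.

Lemma superdiag_sum k (I : Type) (r : seq I) (P : pred I) (D : I -> 'M[F]_n) :
  (forall i, P i -> superdiag k (D i)) -> superdiag k (\sum_(i <- r | P i) D i).
Proof.
move=> hD; elim/big_rec: _ => [|i A Pi hA]; first exact: superdiag0.
exact/superdiagD/hA/hD.
Qed.

Lemma superdiagW k l A : (k <= l)%N -> superdiag l A -> superdiag k A.
Proof. by move=> kl hA i j ij; apply: hA; lia. Qed.

Lemma superdiagM k l A B :
  superdiag k A -> superdiag l B -> superdiag (k + l) (A *m B).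
Proof.
move=> hA hB i j ij; rewrite mxE big1// => m _.
have [mi|im] := ltnP m (i + k); first by rewrite hA ?mul0r.
by rewrite hB ?mulr0//; lia.
Qed.

Lemma superdiag_eq0 k A : (n <= k)%N -> superdiag k A -> A = 0.
Proof.
by move=> nk hA; apply/matrixP=> i j; rewrite mxE hA//; have := ltn_ord j; lia.
Qed.

Lemma superdiag_exp A m : superdiag 1 A -> superdiag m (A ^+ m).
Proof.
move=> hA; elim: m => [|m IH].
  by move=> i j; rewrite expr0 addn0 mxE; case: eqP => // ->; rewrite ltnn.
by rewrite exprS -add1n; apply: superdiagM.
Qed.

End SuperdiagonalFiltration.

(** * Powers of a unitriangular matrix as polynomials in the exponent *)

Lemma poly_rat_ext (p q : {poly rat}) :
  (forall m : nat, p.[m%:R] = q.[m%:R]) -> p = q.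
Proof.
move=> e; apply/eqP; rewrite -subr_eq0; apply/negP => /negP nz.
pose s := [seq m%:R : rat | m <- iota 0 (size (p - q))].
have rs : all (root (p - q)) s.
  by apply/allP => _ /mapP[m _ ->]; rewrite /root hornerD hornerN e subrr.
have us : uniq s.
  by rewrite map_inj_uniq ?iota_uniq// => a b /eqP; rewrite eqr_nat => /eqP.
by have := max_poly_roots nz rs us; rewrite size_map size_iota ltnn.
Qed.

Lemma bin_poly (l : nat) :
  exists q : {poly rat}, forall m : nat, q.[m%:R] = 'C(m, l)%:R.
Proof.
have [q Hq] : exists q : {poly rat}, forall m : nat, q.[m%:R] = (m ^_ l)%:R.
  elim: l => [|l [q Hq]]; first by exists 1 => m; rewrite hornerC ffactn0.
  exists (q * ('X - l%:R%:P)) => m; rewrite hornerM Hq hornerXsubC ffactnSr natrM.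
  have [lm|ml] := leqP l m; first by rewrite natrB.
  by rewrite ffact_small// !mul0r.
exists ((l`!)%:R^-1 *: q) => m; rewrite hornerZ Hq -bin_ffact natrM mulrCA mulVf ?mulr1//.
Qed.

Lemma unitriangular_exp_poly n (A : 'M[rat]_n) (i j : 'I_n) :
  superdiag 1 (A - 1%:M) ->
  exists q : {poly rat}, forall m : nat, (A ^+ m) i j = q.[m%:R].
Proof.
move=> hA; have [b Hb] := choice bin_poly; pose N := A - 1%:M.
exists (\sum_(l < n) (N ^+ l) i j *: b l) => m.
have -> : A = N + 1 by rewrite subrK.
rewrite exprD1n summxE horner_sum.
(* This range covers both sums: beyond m the binomials vanish, and from n on the powers of N do. *)
transitivity (\sum_(l < m.+1 + n) (N ^+ l) i j * 'C(m, l)%:R).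
  rewrite big_split_ord /= [X in _ = _ + X]big1 ?addr0; last first.
    by move=> l _; rewrite bin_small ?mulr0//; lia.
  by apply: eq_bigr => l _; rewrite mulmxnE mulr_natr.
rewrite (addnC m.+1 n) big_split_ord /=.
rewrite [X in _ + X = _]big1 ?addr0; last first.
  move=> l _; have -> : N ^+ (n + l) = 0.
    exact: superdiag_eq0 (leq_addr l n) (superdiag_exp hA).
  by rewrite mxE mul0r.
by apply: eq_bigr => l _; rewrite hornerZ Hb.
Qed.

(** * Word maps on the rational points of a unipotent group *)

Section UnipotentPoints.
Variables (G : affine_group) (n : nat)
  (rho : forall B : comAlgType rat, points G B -> 'M[B]_n).
Hypotheses
  (rhoM : forall (B : comAlgType rat) (p q : points G B),
      rho (p * q)%g = rho p *m rho q)
  (rho_natural : forall (B C : comAlgType rat) (u : {lrmorphism B -> C})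
        (p : points G B),
      rho (base_change u p) = map_mx u (rho p))
  (rho_upper : forall (B : comAlgType rat) (p : points G B) (i j : 'I_n),
      (j <= i)%N -> rho p i j = (i == j)%:R)
  (rho_closed : forall S : {pred coord G}, GRing.subalg_closed S ->
      (forall i j, rho (generic_point G) i j \in S) -> forall a, a \in S).

Notation Gam := (rational_points G).
Implicit Types p q g h : Gam.
Let val_at (p : Gam) : {lrmorphism coord G -> rat^o} := p.
Let mx (p : Gam) : 'M[rat]_n := rho p.

Lemma rho_generic p i j : val_at p (rho (generic_point G) i j) = mx p i j.
Proof.
have e : base_change (val_at p) (generic_point G) = p by exact: lrmorphism_ext.
by rewrite -[in RHS]e /mx rho_natural mxE.
Qed.

(** The functions with equal values at p and q form a subalgebra, and the matrix entries generate
    all functions. *)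
Lemma rho_inj p q : mx p = mx q -> p = q.
Proof.
move=> e; apply: lrmorphism_ext => a; apply/eqP.
apply: (rho_closed (S := [pred a | val_at p a == val_at q a])) => [|i j].
  split=> [|c u v|u v]; rewrite !inE.
  - by rewrite !rmorph1.
  - by move=> /eqP eu /eqP ev; rewrite !linearP /= eu ev.
  - by move=> /eqP eu /eqP ev; rewrite !rmorphM /= eu ev.
by rewrite inE !rho_generic e.
Qed.

Lemma rhoMr p q : mx (p * q)%g = mx p *m mx q.
Proof. exact: (rhoM (B := rat^o) p q). Qed.

Lemma rho_superdiag1 p : superdiag 1 (mx p - 1%:M).
Proof.
move=> i j; rewrite addn1 ltnS => ji; rewrite !mxE [mx p i j](rho_upper p ji).
by case: (i == j); rewrite subrr.
Qed.

(** The image of the unit is idempotent. For N = [mx 1 - 1] this reads N = - N^2, which pushes N up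
    through all superdiagonals. *)
Lemma rho1 : mx 1%g = 1%:M.
Proof.
pose N := mx 1%g - 1%:M.
have NN : N = - (N *m N).
  have := rhoMr 1%g 1%g; rewrite mulg1.
  have -> : mx 1%g = N + 1%:M by rewrite subrK.
  rewrite mulmxDl mulmxDr !mulmx1 mul1mx -[LHS]add0r => /addIr /eqP.
  by rewrite eq_sym addrC addr_eq0 => /eqP.
have H k : superdiag k.+1 N.
  elim: k => [|k IH]; first exact: rho_superdiag1.
  by rewrite NN -add1n; apply/superdiagN/superdiagM/IH/rho_superdiag1.
by apply/eqP; rewrite -subr_eq0; apply/eqP; apply: superdiag_eq0 (H n); exact: leqnSn.
Qed.

Lemma rhoX p m : mx (p ^+ m)%g = mx p ^+ m.
Proof. by elim: m => [|m IH]; rewrite ?expg0 ?rho1 // expgS rhoMr IH exprS. Qed.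

(* Every function on G takes polynomial values in m at h ^+ m; evaluating the
   polynomials at s defines the s-th power of h. *)
Lemma rational_power h (s : rat) : exists p,
  forall i j (q : {poly rat}), (forall m : nat, mx (h ^+ m)%g i j = q.[m%:R]) ->
    mx p i j = q.[s].
Proof.
pose S := [pred a : coord G |
  `[< exists q : {poly rat}, forall m : nat, val_at (h ^+ m)%g a = q.[m%:R] >]].
have cS : GRing.subalg_closed S.
  split=> [|c u v|u v]; rewrite !inE.
  - by exists 1 => m; rewrite rmorph1 hornerC.
  - move=> [qu eu] [qv ev]; exists (c *: qu + qv) => m.
    by rewrite linearP /= eu ev hornerD hornerZ.
  - move=> [qu eu] [qv ev]; exists (qu * qv) => m.
    by rewrite rmorphM /= eu ev hornerM.
have gS i j : rho (generic_point G) i j \in S.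
  rewrite inE; have [q Hq] := unitriangular_exp_poly i j (rho_superdiag1 h).
  by exists q => m; rewrite rho_generic rhoX Hq.
have {cS gS} /choice[Q HQ] : forall a, exists q : {poly rat},
    forall m : nat, val_at (h ^+ m)%g a = q.[m%:R].
  by move=> a; have := rho_closed cS gS a; rewrite inE.
have QE a (q : {poly rat}) :
    (forall m : nat, val_at (h ^+ m)%g a = q.[m%:R]) -> Q a = q.
  by move=> e; apply: poly_rat_ext => m; rewrite -HQ e.
pose f (a : coord G) : rat^o := (Q a).[s].
have f_lin : linear f.
  move=> c u v; rewrite /f (QE _ (c *: Q u + Q v)) ?hornerD ?hornerZ// => m.
  by rewrite linearP /= !HQ hornerD hornerZ.
have f_mul : monoid_morphism f.
  split; first by rewrite /f (QE _ 1) ?hornerC// => m; rewrite rmorph1 hornerC.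
  move=> u v; rewrite /f (QE _ (Q u * Q v)) ?hornerM// => m.
  by rewrite rmorphM /= !HQ hornerM.
pose f_l := GRing.isLinear.Build rat (coord G) rat^o _ f f_lin.
pose f_m := GRing.isMonoidMorphism.Build (coord G) rat^o f f_mul.
pose f_lr : {lrmorphism coord G -> rat^o} := HB.pack f f_l f_m.
exists (f_lr : Gam) => i j q Hq; rewrite -rho_generic; congr (_.[s]).
by apply: QE => m; rewrite rho_generic.
Qed.

(** With N = h - 1, the power h^m is 1 + m N up to level k + 2. On the entries below that level the
    interpolating polynomial is therefore linear in m. *)
Lemma rational_power_lead k h s : superdiag k.+1 (mx h - 1%:M) ->
  exists p, superdiag k.+2 (mx p - 1%:M - s *: (mx h - 1%:M)).
Proof.
move=> hk; have [p Hp] := rational_power h s; exists p.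
pose N := mx h - 1%:M; have hN : mx h = 1%:M + N by rewrite addrC subrK.
have key (A B : 'M[rat]_n) c : A + A *m B - 1%:M - (c + 1) *: B
    = (A - 1%:M - c *: B) + (A - 1%:M - c *: B) *m B + c *: (B *m B).
  rewrite scalerDl scale1r !mulmxBl -scalemxAl mul1mx.
  move: (A *m B) (c *: B) (c *: (B *m B)) => D E K.
  by apply/matrixP=> i j; rewrite !mxE; ring.
have pw m : superdiag k.+2 (mx h ^+ m - 1%:M - m%:R *: N).
  elim: m => [|m IH].
    by rewrite expr0 scale0r subr0 subrr; exact: superdiag0.
  have -> : mx h ^+ m.+1 - 1%:M - m.+1%:R *: N
     = (mx h ^+ m - 1%:M - m%:R *: N)
       + (mx h ^+ m - 1%:M - m%:R *: N) *m N + m%:R *: (N *m N).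
    have -> : mx h ^+ m.+1 = mx h ^+ m + mx h ^+ m *m N.
      rewrite exprSr [X in _ * X]hN.
      exact: etrans (mulmxDr _ _ _) (congr1 (+%R^~ _) (mulmx1 _)).
    by rewrite -natr1 key.
  apply: superdiagD; first apply: superdiagD => //.
    by apply: (@superdiagW _ _ _ (k.+2 + k.+1)); [lia|exact: superdiagM].
  by apply/superdiagZ/(@superdiagW _ _ _ (k.+1 + k.+1)); [lia|exact: superdiagM].
move=> i j ij.
rewrite (_ : _ i j = mx p i j - (i == j)%:R - s * N i j); last by rewrite !mxE.
rewrite (Hp i j ((i == j)%:R%:P + N i j *: 'X)).
  by rewrite hornerD hornerC hornerZ hornerX; ring.
move=> m; rewrite rhoX hornerD hornerC hornerZ hornerX.
have -> : N i j = mx h i j - (i == j)%:R by rewrite !mxE.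
by have := pw m i j ij; rewrite !mxE => /eqP; rewrite subr_eq0 subr_eq => /eqP ->; ring.
Qed.

(** This is the differential of the word map: multiplying a matrix of level k + 1 by a unitriangular
    one changes it only at level k + 2, so the changes of the letters add up, with a minus sign for
    inverse letters. *)
Lemma word_superdiag (X : choiceType) (h h' : X -> Gam) k (u : free_group X) :
    (forall x, superdiag k.+1 (mx (h' x) - mx (h x))) ->
  superdiag k.+2 (mx (fg_lift h' u) - mx (fg_lift h u)
                  - letter_sum (fun x => mx (h' x) - mx (h x)) (word u)).
Proof.
move=> hk; rewrite /fg_lift /letter_sum.
have one r : superdiag 0 (mx r).
  have -> : mx r = (mx r - 1%:M) + 1%:M by rewrite subrK.
  apply: superdiagD; first exact: superdiagW (rho_superdiag1 r).
  by move=> i j; rewrite addn0 mxE => ji; rewrite -val_eqE gtn_eqF.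
have prod_step (A A' D : 'M[rat]_n) (p p' : Gam) (E : 'M[rat]_n) :
    forall q q', mx q = A -> mx q' = A' ->
    superdiag k.+1 D -> superdiag k.+1 E ->
    superdiag k.+2 (A' - A - D) -> superdiag k.+2 (mx p' - mx p - E) ->
    superdiag k.+2 (A' *m mx p' - A *m mx p - (D + E)).
  move=> q q' qA q'A hD hE hA hp.
  have -> : A' *m mx p' - A *m mx p - (D + E)
     = (A' - A - D) *m mx p' + D *m (mx p' - 1%:M)
       + A *m (mx p' - mx p - E) + (A - 1%:M) *m E.
    rewrite !mulmxBl !mulmxBr !mulmx1 !mul1mx.
    move: (A' *m mx p') (A *m mx p') (D *m mx p') (A *m mx p) (A *m E) => a b c d e.
    by apply/matrixP=> i j; rewrite !mxE; ring.
  do !apply: superdiagD.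
  - by rewrite -[k.+2]addn0; apply: superdiagM.
  - by rewrite -[k.+2]addn1; apply: superdiagM => //; exact: rho_superdiag1.
  - by rewrite -qA -[k.+2]add0n; apply: superdiagM.
  - by rewrite -qA -[k.+2]add1n; apply: superdiagM => //; exact: rho_superdiag1.
have letter_step (a : letter X) :
    superdiag k.+2 (mx (letter_val h' a) - mx (letter_val h a)
       - (if a.2 then mx (h' a.1) - mx (h a.1) else - (mx (h' a.1) - mx (h a.1)))).
  rewrite /letter_val; case: a.2; first by rewrite subrr; exact: superdiag0.
  move: (h a.1) (h' a.1) (hk a.1) => p p' hp.
  (* A form of V' - V = - V' (A' - A) V, the difference of two inverses. *)
  have inv_diff (V V' A A' : 'M[rat]_n) : V' *m A' = 1%:M -> A *m V = 1%:M ->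
      V' - V - - (A' - A)
      = - ((V' - 1%:M) *m (A' - A) *m V + (A' - A) *m (V - 1%:M)).
    move=> e1 e2; rewrite [(V' - _) *m _]mulmxBl mul1mx mulmxBr e1 !mulmxBl mul1mx.
    rewrite -mulmxA e2 !mulmxBr !mulmx1 e2.
    by apply/matrixP=> i j; rewrite !mxE; ring.
  rewrite (inv_diff (mx p^-1%g) (mx p'^-1%g)) -?rhoMr ?mulVg ?mulgV ?rho1//.
  apply/superdiagN/superdiagD.
    rewrite -[k.+2]addn0; apply: superdiagM (one _).
    by rewrite -[k.+2]add1n; apply: superdiagM => //; exact: rho_superdiag1.
  by rewrite -[k.+2]addn1; apply: superdiagM => //; exact: rho_superdiag1.
elim: (word u) => [|a w IH] /=.
  by rewrite big_nil !subrr; exact: superdiag0.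
rewrite big_cons !rhoMr; apply: (prod_step _ _ _ _ _ _ _ _ erefl erefl) => //.
  by case: a.2; rewrite ?opprB; [exact: hk|rewrite -opprB; apply/superdiagN/hk].
elim: (w) => [|b w' IH']; first by rewrite big_nil; exact: superdiag0.
rewrite big_cons; apply: superdiagD => //.
by case: b.2; [exact: hk|apply/superdiagN/hk].
Qed.

Section WordMap.
Variables (X : finType) (I : finType) (w : I -> free_group X) (B : X -> I -> rat).
(** The coordinate at x of the class of u in the rationalized abelianization. *)
Definition exponent (u : free_group X) (x : X) : rat :=
  letter_sum (fun x' => (x' == x)%:R) (word u).

Lemma letter_sum_exponent (V : lmodType rat) (phi : X -> V) u :
  letter_sum phi (word u) = \sum_x exponent u x *: phi x.
Proof.
rewrite /letter_sum /exponent /letter_sum; under [RHS]eq_bigr do rewrite scaler_suml.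
rewrite [RHS]exchange_big /=; apply: eq_bigr => a _.
rewrite (bigD1 a.1)//= eqxx big1 ?addr0 => [|x /negPf xa].
  by case: a.2; rewrite ?scaleN1r ?scale1r.
by rewrite eq_sym xa; case: a.2; rewrite ?oppr0 scale0r.
Qed.

Hypotheses
  (hBA : forall x x', \sum_i B x i * exponent (w i) x' = (x == x')%:R)
  (hAB : forall i i', \sum_x exponent (w i) x * B x i' = (i == i')%:R).

(** If the difference D has level k + 1, [word_superdiag] puts the exponent matrix applied to D at
    level k + 2, and applying B recovers D. *)
Lemma word_map_inj (h h' : X -> Gam) :
  (forall i, fg_lift h (w i) = fg_lift h' (w i)) -> h = h'.
Proof.
move=> e; pose D x := mx (h' x) - mx (h x).
have H k : forall x, superdiag k.+1 (D x).
  elim: k => [|k IH] x.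
    have -> : D x = (mx (h' x) - 1%:M) - (mx (h x) - 1%:M) by rewrite opprB addrA subrK.
    by apply: superdiagB; exact: rho_superdiag1.
  have -> : D x = \sum_i B x i *: letter_sum D (word (w i)).
    under eq_bigr do rewrite letter_sum_exponent scaler_sumr.
    rewrite exchange_big /=; under eq_bigr => x' _.
      under eq_bigr do rewrite scalerA.
      rewrite -scaler_suml hBA; over.
    rewrite (bigD1 x)//= eqxx scale1r big1 ?addr0// => x' /negPf nx.
    by rewrite eq_sym nx scale0r.
  apply: superdiag_sum => i _; apply: superdiagZ.
  have := word_superdiag (w i) IH; rewrite e subrr sub0r => /superdiagN.
  by rewrite opprK.
apply/funext => x; apply: rho_inj; apply/esym/eqP; rewrite -subr_eq0; apply/eqP.
exact: superdiag_eq0 (leqnSn n) (H n x).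
Qed.

Lemma foldr_superdiag (T : Type) (s : seq T) (c : T -> Gam) (E : T -> 'M[rat]_n) k :
    (forall i, superdiag k.+1 (E i)) ->
    (forall i, superdiag k.+2 (mx (c i) - 1%:M - E i)) ->
  superdiag k.+2 (mx (foldr (fun i g => c i * g)%g 1%g s) - 1%:M - \sum_(i <- s) E i).
Proof.
move=> hE hc; elim: s => [|i s IH] /=.
  by rewrite rho1 big_nil subr0 subrr; exact: superdiag0.
rewrite rhoMr big_cons; move: (foldr _ _ _) (\sum_(_ <- _) _) IH => p S IH.
have -> : mx (c i) *m mx p - 1%:M - (E i + S) =
  (mx (c i) - 1%:M - E i) + (mx p - 1%:M - S)
  + (mx (c i) - 1%:M - E i) *m (mx p - 1%:M) + E i *m (mx p - 1%:M).
  rewrite !mulmxBl !mulmxBr !mulmx1 !mul1mx.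
  move: (mx (c i) *m mx p) (E i *m mx p) => a b.
  by apply/matrixP=> i' j'; rewrite !mxE; ring.
do !apply: superdiagD => //.
  by apply: superdiagW (superdiagM (hc i) (rho_superdiag1 p)); rewrite addn1.
by rewrite -[k.+2]addn1; apply: superdiagM => //; exact: rho_superdiag1.
Qed.

(** Newton iteration: the errors e_i = w_i(h)^-1 g_i are removed to first order by multiplying h x
    by the product over i of the rational powers of e_i with exponents B x i. *)
Lemma word_map_surj (g : I -> Gam) :
  exists h : X -> Gam, forall i, fg_lift h (w i) = g i.
Proof.
have H k : exists h : X -> Gam, forall i,
    superdiag k.+1 (mx (g i) - mx (fg_lift h (w i))).
  elim: k => [|k [h Hh]].
    exists (fun=> 1%g) => i; move: (fg_lift _ _) => p.
    have -> : mx (g i) - mx p = (mx (g i) - 1%:M) - (mx p - 1%:M).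
      by rewrite opprB addrA subrK.
    by apply: superdiagB; exact: rho_superdiag1.
  pose e i := ((fg_lift h (w i))^-1 * g i)%g; pose E i := mx (e i) - 1%:M.
  have ge i : mx (g i) - mx (fg_lift h (w i)) = mx (fg_lift h (w i)) *m E i.
    by rewrite mulmxBr mulmx1 -rhoMr mulgA mulgV mul1g.
  have hE i : superdiag k.+1 (E i).
    have -> : E i = mx (fg_lift h (w i))^-1%g *m (mx (g i) - mx (fg_lift h (w i))).
      by rewrite ge mulmxA -rhoMr mulVg rho1 mul1mx.
    rewrite -[mx _^-1%g](subrK 1%:M) mulmxDl mul1mx; apply: superdiagD => //.
    by apply: superdiagW (superdiagM (rho_superdiag1 _) (Hh i)); rewrite leq_addl.
  (* [c (x, i)] serves as the power of [e i] with exponent [B x i]; only its leading term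
     matters. *)
  have /choice[c Hc] : forall xi : X * I, exists p : Gam,
      superdiag k.+2 (mx p - 1%:M - B xi.1 xi.2 *: E xi.2).
    by move=> xi; apply: rational_power_lead; exact: hE.
  pose c' x := foldr (fun i g => c (x, i) * g)%g 1%g (index_enum I).
  have Hc' x : superdiag k.+2 (mx (c' x) - 1%:M - \sum_i B x i *: E i).
    by apply: foldr_superdiag => i; [exact/superdiagZ/hE|exact: (Hc (x, i))].
  exists (fun x => h x * c' x)%g => i.
  pose S x := \sum_i B x i *: E i.
  have hS x : superdiag k.+1 (S x) by apply: superdiag_sum => j _; exact/superdiagZ/hE.
  pose D x := mx (h x * c' x)%g - mx (h x).
  have DE x : D x = (mx (h x) - 1%:M) *m (mx (c' x) - 1%:M)
                    + (mx (c' x) - 1%:M - S x) + S x.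
    rewrite /D rhoMr mulmxBl mulmxBr mulmx1 mul1mx.
    move: (mx (h x) *m mx (c' x)) => a.
    by apply/matrixP=> i' j'; rewrite !mxE; ring.
  have hc x : superdiag k.+1 (mx (c' x) - 1%:M).
    rewrite -[mx (c' x) - _](subrK (S x)); apply: superdiagD => //.
    by apply: superdiagW (Hc' x).
  have hDS x : superdiag k.+2 (D x - S x).
    rewrite DE addrK; apply: superdiagD => //.
    by rewrite -[k.+2]add1n; apply: superdiagM => //; exact: rho_superdiag1.
  have hD x : superdiag k.+1 (D x).
    by rewrite -[D x](subrK (S x)); apply: superdiagD => //; exact: superdiagW (hDS x).
  have SE : \sum_x exponent (w i) x *: S x = E i.
    under eq_bigr do rewrite scaler_sumr.
    rewrite exchange_big /=; under eq_bigr => j _.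
      under eq_bigr do rewrite scalerA.
      rewrite -scaler_suml hAB; over.
    rewrite (bigD1 i)//= eqxx scale1r big1 ?addr0// => j /negPf ni.
    by rewrite eq_sym ni scale0r.
  have := word_superdiag (w i) hD; rewrite letter_sum_exponent -/D => hw.
  have hDE : superdiag k.+2 (\sum_x exponent (w i) x *: D x - E i).
    rewrite -SE -sumrB; apply: superdiag_sum => x _; rewrite -scalerBr.
    exact: superdiagZ.
  have hgE : superdiag k.+2 (mx (g i) - mx (fg_lift h (w i)) - E i).
    rewrite ge -[X in _ - X]mul1mx -mulmxBl -[k.+2]add1n.
    by apply: superdiagM => //; exact: rho_superdiag1.
  (* The new error g - w(h') is a combination of three differences of level k + 2. *)
  have := superdiagB (superdiagB hgE hw) hDE.
  congr superdiag; rewrite /D; move: (\sum_x _ *: _) => T.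
  by apply/matrixP=> i' j'; rewrite !mxE; ring.
have [h Hh] := H n; exists h => i; apply: rho_inj; apply/esym/eqP.
by rewrite -subr_eq0; apply/eqP; exact: superdiag_eq0 (leqnSn n) (Hh i).
Qed.

End WordMap.
End UnipotentPoints.

Lemma fg_lift_comp (X : choiceType) (G H : groupType) (f : {multiplicative G -> H})
    (h : X -> G) (u : free_group X) : f (fg_lift h u) = fg_lift (f \o h) u.
Proof.
apply: (fg_hom_ext (h := f \o fg_lift h)) => x /=.
by rewrite !fg_lift_gen.
Qed.

Definition rational_map (G H : affine_group) (f : gs_hom G H) :
    {multiplicative rational_points G -> rational_points H} := @on_points G H f rat^o.

(** * Passage from unipotent to prounipotent groups *)

Section BijectiveWordMaps.
Variables (X I : finType) (w : I -> free_group X) (B : X -> I -> rat).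
Hypotheses
  (hBA : forall x x', \sum_i B x i * exponent (w i) x' = (x == x')%:R)
  (hAB : forall i i', \sum_x exponent (w i) x * B x i' = (i == i')%:R).

Lemma unipotent_word_map (G : affine_group) (g : I -> rational_points G) :
  unipotent G -> exists! h : X -> rational_points G, forall i, fg_lift h (w i) = g i.
Proof.
move=> [n [rho [rhoM rhoN rhoU rhoC]]].
have [h hg] := word_map_surj rhoM rhoN rhoU rhoC hAB g.
exists h; split=> // h' h'g; apply: (word_map_inj rhoM rhoN rhoU rhoC hBA) => i.
by rewrite hg h'g.
Qed.

(** Uniqueness of the solution in each unipotent term makes the solutions compatible with the
    transition maps, so they define points of the limit. *)
Lemma prounipotent_word_map (G : affine_group) (g : I -> rational_points G) :
  prounipotent G -> exists! h : X -> rational_points G, forall i, fg_lift h (w i) = g i.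
Proof.
move=> [U [pr [uniU [pr_comp pr_lim]]]].
have ext (p q : rational_points G) :
    (forall k, on_points (pr k) p = on_points (pr k) q) -> p = q.
  move=> pq; have := pr_lim rat^o (fun k => on_points (pr k) q).
  case=> [k l kl|r [_ r_uniq]].
    by rewrite -(pr_comp _ _ kl); exact: lrmorphism_ext.
  by rewrite -(r_uniq p pq) -(r_uniq q).
have solvable_at k :=
  cid (unipotent_word_map (fun i => on_points (pr k) (g i)) (uniU k)).
have [hk Hk] : exists hk : forall k, X -> rational_points (term k), forall k,
    unique (fun h => forall i, fg_lift h (w i) = on_points (pr k) (g i)) (hk k).
  by exists (fun k => projT1 (solvable_at k)) => k; exact: projT2 (solvable_at k).
have hk_compat x k l (kl : idx_le k l) : on_points (transition kl) (hk l x) = hk k x.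
  have [_ uniq_k] := Hk k.
  rewrite (uniq_k (fun x => on_points (transition kl) (hk l x))) // => i.
  rewrite -[LHS](fg_lift_comp (rational_map (transition kl))) (Hk l).1.
  by rewrite -(pr_comp _ _ kl); exact: lrmorphism_ext.
have /choice[h Hh] := fun x => pr_lim rat^o (fun k => hk k x) (hk_compat x).
exists h; split=> [i|h' h'g].
  apply: ext => k; rewrite (fg_lift_comp (rational_map (pr k))) -(Hk k).1; congr fg_lift.
  by apply/funext => x /=; rewrite (Hh x).1.
apply/funext => x; apply: (Hh x).2 => k.
have [_ uniq_k] := Hk k.
rewrite (uniq_k (fun x => on_points (pr k) (h' x))) // => i.
by rewrite -[LHS](fg_lift_comp (rational_map (pr k))) h'g.
Qed.

End BijectiveWordMaps.

(** * Completing independent rows to an invertible matrix *)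

Lemma sum_enum_val (T : finType) (V : zmodType) (F : T -> V) :
  \sum_x F x = \sum_(c < #|T|) F (enum_val c).
Proof. by rewrite -big_enum_val; apply: eq_bigl. Qed.

(** A right inverse makes the rows of A independent, so A has an invertible minor of size |Y|. Unit
    rows at the remaining columns complete A. *)
Lemma complete_to_basis (X Y : finType) (A : Y -> X -> rat) (C : X -> Y -> rat) :
    (forall y y', \sum_x A y x * C x y' = (y == y')%:R) ->
  (#|Y| <= #|X|)%N /\
  (forall Z : finType, #|Z| = (#|X| - #|Y|)%N ->
   exists (j : Z -> X) (B : X -> Y + Z -> rat),
     let A' i x := match i with inl y => A y x | inr z => (j z == x)%:R end in
     (forall x x', \sum_i B x i * A' i x' = (x == x')%:R) /\
     (forall i i', \sum_x A' i x * B x i' = (i == i')%:R)).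
Proof.
move=> AC; pose MA := \matrix_(r < #|Y|, c < #|X|) A (enum_val r) (enum_val c).
have freeA : row_free MA.
  apply/row_freeP; exists (\matrix_(c, r) C (enum_val c) (enum_val r)).
  apply/matrixP=> r r'; rewrite !mxE -(inj_eq enum_val_inj) -AC.
  rewrite [RHS]sum_enum_val.
  by apply: eq_bigr => c _; rewrite !mxE.
have YX : (#|Y| <= #|X|)%N by rewrite -(eqP freeA) rank_leq_col.
split=> // Z cardZ.
have fullA : row_full MA^T by rewrite /row_full mxrank_tr.
(* The columns of the invertible minor. *)
pose f (y : Y) : X := enum_val (fullrankfun fullA (enum_rank y)).
have f_inj : injective f.
  by move=> y y' /enum_val_inj/fullrankfun_inj/enum_rank_inj.
pose D := ~: [set f y | y : Y].
have cardD : #|D| = #|Z| by rewrite cardsCs finset.setCK card_imset// cardZ.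
pose j (z : Z) : X := enum_val (cast_ord (esym cardD) (enum_rank z)).
have jP x : (forall y, f y != x) -> exists z, j z = x.
  move=> nf; have xD : x \in D.
    by rewrite inE; apply/imsetP => -[y _ e]; have := nf y; rewrite e eqxx.
  exists (enum_val (cast_ord cardD (enum_rank_in xD x))).
  by rewrite /j enum_valK cast_ordK enum_rankK_in.
exists j; pose A' i x := match i with inl y => A y x | inr z => (j z == x)%:R end : rat.
pose M := \matrix_(r < #|{: Y + Z}|, c < #|X|) A' (enum_val r) (enum_val c).
(* A vector killed by all rows of M vanishes outside the minor because of the unit rows, and then on
   the minor because that is invertible. *)
have freeM : row_free M^T.
  apply: inj_row_free => v vM.
  have vA (i : Y + Z) : \sum_x v 0 (enum_rank x) * A' i x = 0.
    have /matrixP/(_ 0 (enum_rank i)) := vM; rewrite !mxE => e; rewrite -[RHS]e {e}.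
    rewrite [LHS]sum_enum_val.
    by apply: eq_bigr => c _; rewrite !mxE enum_valK enum_rankK.
  have vZ z : v 0 (enum_rank (j z)) = 0.
    have := vA (inr z); rewrite (bigD1 (j z))//= eqxx mulr1 big1 ?addr0// => x.
    by rewrite eq_sym => /negPf->; rewrite mulr0.
  pose u := \row_(r < #|Y|) v 0 (fullrankfun fullA r).
  have u0 : u = 0.
    have uS : u *m rowsub (fullrankfun fullA) MA^T = 0.
      apply/matrixP=> i r; rewrite ord1 !mxE -[RHS](vA (inl (enum_val r))) /=.
      rewrite (bigID (mem [set f y | y : Y])) /= [X in _ + X]big1 ?addr0; last first.
        move=> x xf; have [|z <-] := jP x; last by rewrite vZ mul0r.
        by move=> y; apply: contra xf => /eqP<-; rewrite imset_f.
      rewrite big_imset /=; last by move=> y y' _ _; exact: f_inj.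
      rewrite [RHS]sum_enum_val.
      by apply: eq_bigr => c _; rewrite !mxE /f !enum_valK.
    by rewrite -[u](mulmxK (fullrowsub_unit fullA)) uS mul0mx.
  apply/rowP=> c; rewrite mxE -[c]enum_valK.
  have [[y <-]|nf] := pselect (exists y, f y = enum_val c).
    by have /rowP/(_ (enum_rank y)) := u0; rewrite !mxE /f enum_valK.
  have [y|z <-] := jP (enum_val c); last exact: vZ.
  by apply/eqP => e; apply: nf; exists y.
have cardYZ : #|{: Y + Z}| = #|X| by rewrite card_sum cardZ subnKC.
have rankM : \rank M = #|X| by rewrite -mxrank_tr (eqP freeM).
have /row_fullP[B BM] : row_full M by rewrite /row_full rankM.
have /row_freeP[B' MB'] : row_free M by rewrite /row_free rankM cardYZ.
have MB : M *m B = 1%:M by rewrite -(mulmx1 B) -MB' mulmxA BM mul1mx.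
exists (fun x i => B (enum_rank x) (enum_rank i)) => A''; split=> [x x'|i i'].
  rewrite [LHS]sum_enum_val.
  have /matrixP/(_ (enum_rank x) (enum_rank x')) := BM.
  rewrite !mxE (inj_eq enum_rank_inj) => <-.
  by apply: eq_bigr => c _; rewrite !mxE enum_valK enum_rankK.
rewrite [LHS]sum_enum_val.
have /matrixP/(_ (enum_rank i) (enum_rank i')) := MB.
rewrite !mxE (inj_eq enum_rank_inj) => <-.
by apply: eq_bigr => c _; rewrite !mxE enum_valK enum_rankK.
Qed.

(** * The simplicial homotopy equivalence *)



Lemma dependent_choice_fun (I : Type) (T : I -> Type) (A : forall i, T i -> Prop) :
  (forall i, exists x, A i x) -> exists f : forall i, T i, forall i, A i (f i).
Proof.
move=> ex; exists (fun i => projT1 (cid (ex i))) => i; exact: projT2 (cid (ex i)).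
Qed.

Definition eval_at (G H : prounipotent_cat) (f : hom G H)
    (p : rational_points (G : prounipotent_group)) :
    rational_points (H : prounipotent_group) := rational_map (f : gs_hom _ _) p.

Lemma eval_comp (G H K : prounipotent_cat) (f : hom G H) (g : hom H K) p :
  eval_at (g \oc f) p = eval_at g (eval_at f p).
Proof. exact: lrmorphism_ext. Qed.

Lemma eval_id (G : prounipotent_cat) p : eval_at (idc G) p = p.
Proof. exact: lrmorphism_ext. Qed.

Lemma eval1 (G H : prounipotent_cat) (f : hom G H) : eval_at f 1%g = 1%g.
Proof. exact: multiplicative1. Qed.

(** * Maps out of the completion of a free group *)

Section FreeCompletion.
Variables (X : choiceType) (G : prounipotent_cat)
  (eta : {multiplicative free_group X -> rational_points (G : prounipotent_group)}).
Hypothesis eta_completion : @is_prounipotent_completion (free_group X) G eta.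

Lemma free_completion_ext (H : prounipotent_cat) (f g : hom G H) :
  (forall x, eval_at f (eta (fg_gen x)) = eval_at g (eta (fg_gen x))) -> f = g.
Proof.
move=> fg; have [_ /(_ H (rational_map (f : gs_hom _ _) \o eta))] := eta_completion.
case=> e [_ e_uniq]; rewrite -(e_uniq f) // -(e_uniq g) // => u.
exact/esym/(fg_hom_ext (h := rational_map (f : gs_hom _ _) \o eta)
  (k := rational_map (g : gs_hom _ _) \o eta)).
Qed.

Lemma free_completion_hom (H : prounipotent_cat)
    (a : X -> rational_points (H : prounipotent_group)) :
  exists f : hom G H, forall u, eval_at f (eta u) = fg_lift a u.
Proof.
have [_ /(_ H (fg_lift a))[f [fE _]]] := eta_completion.
by exists f.
Qed.

End FreeCompletion.

(** * Contraction of the completed simplicial group *)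

Section Contraction.
Variables (Q : presentation) (Z : finType) (j : Z -> gens Q).

(* The relators together with the generators indexed by Z freely generate the
   prounipotent completion of the free group on the generators. *)
Hypothesis relators_basis : forall (G : prounipotent_group)
    (b : rels Q -> rational_points G) (a : Z -> rational_points G),
  exists! h : gens Q -> rational_points G,
    (forall y, fg_lift h (relator y) = b y) /\ (forall z, h (j z) = a z).

Variables (hatP : simplicial prounipotent_cat)
  (eta : forall n, {multiplicative (free_simplicial_group Q n : groupType) ->
                      rational_points (hatP n : prounipotent_group)}).
Hypothesis eta_completion : is_degreewise_completion eta.

Definition gen_pt n z := eta n (fg_gen (inl (j z) : simplex_gens Q n)).
(** The image of y o theta when theta sends k vertices to 0. The value k = n.+1 gives the relator
    itself, which belongs to the new basis. *)
Definition rel_pt n y k := eta n (simplex_rel n y k).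

Lemma rel_pt0 n y : rel_pt n y 0 = 1%g.
Proof. exact: (multiplicative1 (eta n)). Qed.

Let eta_n n :
  @is_prounipotent_completion (free_group (simplex_gens Q n)) (hatP n) (eta n).
Proof. by case: eta_completion => e _ _; exact: e. Qed.

Lemma face_gen n i z : eval_at (face hatP i) (gen_pt n.+1 z) = gen_pt n z.
Proof.
have [_ + _] := eta_completion => /(_ n i _)/esym => e.
by rewrite /gen_pt /eval_at /rational_map [LHS]e; congr (eta n _); exact: fsg_face_inl.
Qed.

Lemma dgn_gen n i z : eval_at (dgn hatP i) (gen_pt n z) = gen_pt n.+1 z.
Proof.
have [_ _] := eta_completion => /(_ n i _)/esym => e.
by rewrite /gen_pt /eval_at /rational_map [LHS]e; congr (eta _ _); exact: fsg_dgn_inl.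
Qed.

Lemma face_rel n (i : 'I_n.+2) y k : (k <= n.+2)%N ->
  eval_at (face hatP i) (rel_pt n.+1 y k) = rel_pt n y (k - (i < k)%N).
Proof.
move=> kn; have [_ + _] := eta_completion => /(_ n i _)/esym => e.
by rewrite /rel_pt /eval_at /rational_map [LHS]e; congr (eta n _); exact: fsg_face_rel.
Qed.

Lemma dgn_rel n (i : 'I_n.+1) y k : (k <= n.+1)%N ->
  eval_at (dgn hatP i) (rel_pt n y k) = rel_pt n.+1 y (k + (i < k)%N).
Proof.
move=> kn; have [_ _] := eta_completion => /(_ n i _)/esym => e.
by rewrite /rel_pt /eval_at /rational_map [LHS]e; congr (eta _ _); exact: fsg_dgn_rel.
Qed.

Lemma simplex_rel_last n y :
  simplex_rel n y n.+1 = fg_map (fun x => inl x : simplex_gens Q n) (relator y).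
Proof. by rewrite /simplex_rel insubF ?ltnn. Qed.

(** The new basis determines maps: the elements with k = n.+1 are the relators, which together with
    Z replace the generators of degree 0 by [relators_basis]. *)
Lemma hat_ext n (H : prounipotent_cat) (f g : hom (hatP n) H) :
    (forall z, eval_at f (gen_pt n z) = eval_at g (gen_pt n z)) ->
    (forall y k, (0 < k <= n.+1)%N ->
       eval_at f (rel_pt n y k) = eval_at g (rel_pt n y k)) ->
  f = g.
Proof.
move=> e_gen e_rel; apply: (free_completion_ext (@eta_n n)) => -[x|[y i]]; last first.
  by rewrite -!simplex_relS; apply: e_rel; rewrite /= ltnW // ltnS ltn_ord.
pose h (f : hom (hatP n) H) x := eval_at f (eta n (fg_gen (inl x : simplex_gens Q n))).
have hE (f' : hom (hatP n) H) u :
    fg_lift (h f') u = eval_at f' (eta n (fg_map (fun x => inl x : simplex_gens Q n) u)).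
  apply: (fg_hom_ext (h := fg_lift (h f'))
    (k := rational_map (f' : gs_hom _ _) \o eta n \o fg_map _)) => x' /=.
  by rewrite fg_lift_gen fg_map_gen.
have [h0 [_ h0_uniq]] :=
  relators_basis (fun y => fg_lift (h f) (relator y)) (fun z => h f (j z)).
rewrite -/(h f x) -/(h g x) -(h0_uniq (h f)) // -(h0_uniq (h g)) //.
split=> [y|z]; last exact/esym/e_gen.
by rewrite !hE -simplex_rel_last; apply/esym/e_rel; rewrite /= leqnn.
Qed.

(** Maps can be prescribed on the new basis: [relators_basis] turns the values on Z and on the
    relators into values on the original generators. At k = 0 the value must be 1 because d_0 y =
    1. *)
Lemma hat_hom n (H : prounipotent_cat)
    (a : Z -> rational_points (H : prounipotent_group))
    (b : rels Q -> nat -> rational_points (H : prounipotent_group)) :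
    (forall y, b y 0 = 1%g) ->
  exists f : hom (hatP n) H, (forall z, eval_at f (gen_pt n z) = a z) /\
    (forall y k, (k <= n.+1)%N -> eval_at f (rel_pt n y k) = b y k).
Proof.
move=> b0; have [h [[h_rel h_gen] _]] := relators_basis (fun y => b y n.+1) a.
pose c (v : simplex_gens Q n) := match v with inl x => h x | inr (y, i) => b y i.+1 end.
have [f fE] := free_completion_hom (@eta_n n) c.
exists f; split=> [z|y [|k]]; first by rewrite [LHS]fE fg_lift_gen /= h_gen.
  by rewrite rel_pt0 eval1 b0.
rewrite ltnS leq_eqVlt => /predU1P[->|kn].
  rewrite [LHS]fE simplex_rel_last -h_rel.
  apply: (fg_hom_ext (h := fg_lift c \o fg_map _)) => x /=.
  by rewrite fg_map_gen !fg_lift_gen.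
by rewrite [LHS]fE (simplex_relS y (Ordinal kn)) fg_lift_gen.
Qed.

Variables (F : prounipotent_cat)
  (iota : {multiplicative free_group Z -> rational_points (F : prounipotent_group)}).
Hypothesis iota_completion : @is_prounipotent_completion (free_group Z) F iota.

(* With k the number of vertices that theta sends to 0, the i-th component of the
   homotopy sends y o theta in degree n to the one with minn k i.+1 such vertices. *)
Lemma free_completion_retract :
  exists (f : simplicial_map hatP (const_simplicial F))
         (g : simplicial_map (const_simplicial F) hatP),
    inhabited (simplicial_homotopy (simplicial_comp g f) (simplicial_id hatP)) /\
    inhabited (simplicial_homotopy (simplicial_comp f g)
                 (simplicial_id (const_simplicial F))).
Proof.
have [f fP] := dependent_choice_fun (fun n =>
  @hat_hom n F (fun z => iota (fg_gen z)) (fun _ _ => 1%g) (fun=> erefl)).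
have f_gen n z : eval_at (f n) (gen_pt n z) = iota (fg_gen z) := (fP n).1 z.
have f_rel n y k : (k <= n.+1)%N -> eval_at (f n) (rel_pt n y k) = 1%g := (fP n).2 y k.
have [g gP] := dependent_choice_fun (fun n =>
  free_completion_hom iota_completion (gen_pt n)).
have g_gen n z : eval_at (g n) (iota (fg_gen z)) = gen_pt n z.
  by rewrite gP fg_lift_gen.
have [h hP] := dependent_choice_fun (fun ni : {n & 'I_n.+1} =>
  @hat_hom (tag ni) (hatP (tag ni).+1) (gen_pt (tag ni).+1)
    (fun y k => rel_pt (tag ni).+1 y (minn k (tagged ni).+1))
    (fun y => etrans (congr1 _ (min0n _)) (rel_pt0 _ y))).
pose h_ n (i : 'I_n.+1) : hom (hatP n) (hatP n.+1) := h (Tagged (fun n => 'I_n.+1) i).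
have h_gen n (i : 'I_n.+1) z : eval_at (h_ n i) (gen_pt n z) = gen_pt n.+1 z.
  exact: (hP (Tagged (fun n => 'I_n.+1) i)).1.
have h_rel n (i : 'I_n.+1) y k : (k <= n.+1)%N ->
    eval_at (h_ n i) (rel_pt n y k) = rel_pt n.+1 y (minn k i.+1).
  exact: (hP (Tagged (fun n => 'I_n.+1) i)).2.
have f_face n (i : 'I_n.+2) :
    face (const_simplicial F) i \oc f n.+1 = f n \oc face hatP i.
  apply: hat_ext => [z|y k /andP[k0 kn]]; rewrite !eval_comp eval_id.
    by rewrite face_gen !f_gen.
  by have ilt := ltn_ord i; rewrite face_rel // !f_rel //; lia.
have f_dgn n (i : 'I_n.+1) :
    dgn (const_simplicial F) i \oc f n = f n.+1 \oc dgn hatP i.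
  apply: hat_ext => [z|y k /andP[k0 kn]]; rewrite !eval_comp eval_id.
    by rewrite dgn_gen !f_gen.
  by rewrite dgn_rel // !f_rel //; lia.
have g_face n (i : 'I_n.+2) :
    face hatP i \oc g n.+1 = g n \oc face (const_simplicial F) i.
  apply: (free_completion_ext iota_completion) => z.
  by rewrite !eval_comp eval_id !g_gen face_gen.
have g_dgn n (i : 'I_n.+1) :
    dgn hatP i \oc g n = g n.+1 \oc dgn (const_simplicial F) i.
  apply: (free_completion_ext iota_completion) => z.
  by rewrite !eval_comp eval_id !g_gen dgn_gen.
exists (@SimplicialMap _ hatP (const_simplicial F) f f_face f_dgn).
exists (@SimplicialMap _ (const_simplicial F) hatP g g_face g_dgn).
split; constructor; last first.
  (* Here the composite is the identity in every degree, so the constant homotopy serves. *)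
  have fgE n : f n \oc g n = idc F.
    apply: (free_completion_ext iota_completion) => z.
    by rewrite eval_comp eval_id g_gen f_gen.
  exists (fun n _ => idc F) => // n; last exact: comp_idl.
  exact: etrans (comp_idl _) (esym (fgE n)).
exists h_ => /=.
(* For k > 0, [minn k 1] is 1; d_0 removes the only vertex over 0, so y o theta goes to 1, as under
   g f. *)
- move=> n; apply: hat_ext => [z|y k /andP[k0 kn]]; rewrite !eval_comp.
    by rewrite h_gen face_gen f_gen g_gen.
  rewrite h_rel // face_rel ?f_rel // ?eval1 /=; last lia.
  by rewrite (_ : (_ - _)%N = 0%N) ?rel_pt0//; lia.
(* At the other end [minn k n.+1] is k, and the removed last vertex lies over 1, so k is
   unchanged. *)
- move=> n; apply: hat_ext => [z|y k /andP[k0 kn]]; rewrite !eval_comp eval_id.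
    by rewrite h_gen face_gen.
  by rewrite h_rel // face_rel /=; [congr rel_pt|]; lia.
- move=> n i l il; apply: hat_ext => [z|y k /andP[k0 kn]]; rewrite !eval_comp.
    by rewrite !(h_gen, face_gen).
  have ilt := ltn_ord i; have llt := ltn_ord l.
  by rewrite h_rel // !face_rel ?h_rel ?shiftE ?widenE; [congr rel_pt|..]; lia.
- move=> n l; apply: hat_ext => [z|y k /andP[k0 kn]]; rewrite !eval_comp.
    by rewrite !(h_gen, face_gen).
  have llt := ltn_ord l.
  by rewrite !h_rel // !face_rel ?shiftE ?widenE; [congr rel_pt|..]; lia.
- move=> n i l il; apply: hat_ext => [z|y k /andP[k0 kn]]; rewrite !eval_comp.
    by rewrite !(h_gen, face_gen).
  have ilt := ltn_ord i; have llt := ltn_ord l.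
  by rewrite h_rel // !face_rel ?h_rel ?shiftE ?widenE; [congr rel_pt|..]; lia.
- move=> n i l il; apply: hat_ext => [z|y k /andP[k0 kn]]; rewrite !eval_comp.
    by rewrite !(h_gen, dgn_gen).
  have ilt := ltn_ord i; have llt := ltn_ord l.
  by rewrite h_rel // !dgn_rel ?h_rel ?shiftE ?widenE; [congr rel_pt|..]; lia.
- move=> n i l il; apply: hat_ext => [z|y k /andP[k0 kn]]; rewrite !eval_comp.
    by rewrite !(h_gen, dgn_gen).
  have ilt := ltn_ord i; have llt := ltn_ord l.
  by rewrite h_rel // !dgn_rel ?h_rel ?shiftE ?widenE; [congr rel_pt|..]; lia.
Qed.

End Contraction.

(** * Letter sums as homomorphisms *)

Section LetterSumMorphism.
Variables (X : choiceType) (V : zmodType) (phi : X -> V).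

(** Two cancelling letters contribute opposite values, so free reduction does not affect the sum. *)
Lemma letter_sum_push a (w : seq (letter X)) :
  letter_sum phi (push a w) = (if a.2 then phi a.1 else - phi a.1) + letter_sum phi w.
Proof.
rewrite /letter_sum; case: w => [|b w] /=; first by rewrite big_seq1 big_nil addr0.
case: ifP => [/eqP->|_]; last by rewrite big_cons.
by rewrite big_cons /=; case: a.2; rewrite /= ?addKr ?addNKr.
Qed.

Lemma letter_sumM (u v : free_group X) :
  letter_sum phi (word (u * v)%g) = letter_sum phi (word u) + letter_sum phi (word v).
Proof.
rewrite /=; elim: (word u) => [|a w IH] /=; first by rewrite /letter_sum big_nil add0r.
by rewrite letter_sum_push IH [in RHS]/letter_sum big_cons addrA.
Qed.

End LetterSumMorphism.

Lemma letter_sum_map (X Y : choiceType) (V : zmodType) (f : X -> Y) (phi : Y -> V)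
    (u : free_group X) :
  letter_sum phi (word (fg_map f u)) = letter_sum (phi \o f) (word u).
Proof.
rewrite /fg_map /= /fg_lift; elim: (word u) => [|[x b] w IH].
  by rewrite /letter_sum !big_nil.
rewrite [foldr _ _ _]/= letter_sumM IH [in RHS]/letter_sum big_cons; congr (_ + _).
by rewrite /letter_val /letter_sum; case: b; rewrite /= big_seq1.
Qed.

Lemma letter_sum_intr (X : choiceType) (phi : X -> int) (w : seq (letter X)) :
  letter_sum (fun x => (phi x)%:~R) w = (letter_sum phi w)%:~R :> rat.
Proof.
rewrite /letter_sum rmorph_sum; apply: eq_bigr => a _.
by case: a.2; rewrite //= rmorphN.
Qed.

Theorem corollary3p8 (R : realType) (P : presentation)
    (S : finite_subpresentation P) (contrP : contractible_presentation R P) :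
  (#|` sub_rels S| <= #|` sub_gens S|)%N /\
  forall (Z : finType)
    (cardZ : #|Z| = (#|` sub_gens S| - #|` sub_rels S|)%N)
    (hatP : simplicial prounipotent_cat)
    (eta : forall n : nat,
       {multiplicative
          (free_simplicial_group (subpresentation S) n : groupType) ->
          rational_points (hatP n : prounipotent_group)})
    (eta_completion : is_degreewise_completion eta)
    (F : prounipotent_group)
    (iota : {multiplicative free_group Z -> rational_points F})
    (iota_completion : is_prounipotent_completion iota),
  exists (f : simplicial_map hatP (const_simplicial (F : prounipotent_cat)))
         (g : simplicial_map (const_simplicial (F : prounipotent_cat)) hatP),
    inhabited (simplicial_homotopy (simplicial_comp g f) (simplicial_id hatP)) /\
    inhabited (simplicial_homotopy (simplicial_comp f g)
                 (simplicial_id (const_simplicial (F : prounipotent_cat)))).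
Proof.
pose X : finType := sub_gens S; pose Y : finType := sub_rels S.
pose r (y : Y) : free_group X := relator (p := subpresentation S) y.
have rE (y : Y) : fg_map val (r y) = relator (val y).
  exact/eqP/(xchooseP (sub_relP y)).
(* For each y0 in Y_1, a cochain on X dual to y0 among the relators of Y_1. *)
have /choice[phi phiE] : forall y0 : Y, exists phi : gens P -> int, forall y : Y,
    letter_sum phi (word (relator (val y))) = (val y == val y0)%:Z.
  move=> y0; have [phi Hphi] :=
    contractible_relators_independent (val y0) (sub_rels S) contrP.
  by exists phi => y; apply: Hphi; exact: valP.
(* Restricted to X_1, these cochains form a right inverse C of the exponent matrix A. *)
pose A (y : Y) (x : X) := exponent (r y) x.
pose C (x : X) (y0 : Y) : rat := (phi y0 (val x))%:~R.
have AC y y0 : \sum_x A y x * C x y0 = (y == y0)%:R.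
  rewrite -[LHS](letter_sum_exponent (V := rat^o) (fun x => C x y0) (r y)).
  rewrite letter_sum_intr -(letter_sum_map val (phi y0)) rE phiE (inj_eq val_inj).
  by rewrite pmulrn.
have [cardYX complete] := complete_to_basis AC.
split=> [|Z]; first by rewrite !cardfE.
rewrite !cardfE => cardZ hatP eta eta_completion F iota iota_completion.
have [j [B]] := complete _ cardZ.
(* The relators and the completing generators, whose exponent matrix has the inverse B. *)
pose w (i : Y + Z) : free_group X := match i with inl y => r y | inr z => fg_gen (j z) end.
have -> : (fun (i : Y + Z) (x : X) =>
    match i with inl y => A y x | inr z => (j z == x)%:R end) = (fun i => exponent (w i)).
  apply/funext => -[y|z]; apply/funext => x //=.
  by rewrite /exponent /letter_sum big_seq1.
move=> [BA AB].
apply: (@free_completion_retract (subpresentation S) Z j _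
          hatP eta eta_completion F iota) => //.
(* The hypothesis [relators_basis] is the bijectivity of the word map of [w] on each prounipotent
   group. *)
move=> G b a.
have [h [hw h_uniq]] := prounipotent_word_map BA AB
  (fun i => match i with inl y => b y | inr z => a z end) (schemeP G).
exists h; split=> [|h' [h'b h'a]].
  split=> [y|z]; first exact: (hw (inl y)).
  by have := hw (inr z); rewrite /= fg_lift_gen.
by apply: h_uniq => -[y|z] /=; rewrite ?h'b ?fg_lift_gen ?h'a.
Qed.
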